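(* (In ZFC.) Let $\mathfrak c=2^{\aleph_0}$. Every torsion-free Abelian group $G$ of cardinality $\mathfrak c$ admits a Hausdorff countably compact group topology in which every convergent sequence is eventually constant.
   Context: A group topology on a group is a topology making the group operation and inversion continuous. A space is countably compact if every countable open cover has a finite subcover (for $T_1$ spaces, equivalently, every countably infinite subset has an accumulation point). *)

(* Defs.v *)
From HB Require Import structures.
From mathcomp Require Import all_boot all_order all_algebra.
From mathcomp Require Import all_classical all_reals all_analysis.

Set Implicit Arguments.
Unset Strict Implicit.
Unset Printing Implicit Defensive.

Import GRing.Theory.
Local Open Scope classical_set_scope.
Local Open Scope ring_scope.

Definition torsion_free (G : zmodType) : Prop :=
  forall (x : G) (n : nat), (0 < n)%N -> x *+ n = 0 -> x = 0.

(* A topology on the carrier of G is an inhabitant t of [Topological G]; the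
   resulting space is [Topological.Pack t], whose carrier is convertible to
   that of G, so the operations below are those of G itself.  The equality and
   choice structures bundled in t need not be those of G, but neither affects
   the topological notions. *)
Definition group_topology (G : zmodType) (t : Topological G) : Prop :=
  let T := Topological.Pack t in
  continuous (fun z : T * T => ((z.1 : G) + (z.2 : G)) : T) /\
  continuous (fun x : T => (- (x : G)) : T).

(* The library's [cover_compact], restricted to countable index sets. *)
Definition countably_compact (T : topologicalType) (A : set T) : Prop :=
  forall (I : choiceType) (D : set I) (f : I -> set T),
    countable D -> (forall i, D i -> open (f i)) -> A `<=` cover D f ->
    finite_subset_cover D f A.

Definition eventually_constant (T : Type) (u : nat -> T) : Prop :=
  exists c : T, \forall n \near \oo, u n = c.

(* Main.v *)
Require Import Defs.
From HB Require Import structures.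
From mathcomp Require Import all_boot all_order all_algebra.
From mathcomp Require Import all_classical all_reals all_analysis.
From mathcomp Require wochoice.
From mathcomp Require Rstruct.
From mathcomp Require Import zify ring lra.

Set Implicit Arguments.
Unset Strict Implicit.
Unset Printing Implicit Defensive.

Import Order.TTheory GRing.Theory Num.Theory.
Import numFieldNormedType.Exports.

Local Open Scope classical_set_scope.
Local Open Scope card_scope.
Local Open Scope ring_scope.

(** Let a character of [G] be a map [G -> R] that is additive modulo 1.  The
topology is the coarsest one that makes a family [F] of characters continuous.
To each sequence [f] with infinite range are attached two distinct points
[xi (f, true)] and [xi (f, false)], and to each of these an ultrafilter on
[nat * nat] together with a double sequence [g] of values of [f].  The family
consists of the characters [phi] such that [phi] of [g] tends to [phi] of [xi]
along the ultrafilter, for all these requirements at once.  Every [f] with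
infinite range then accumulates at two points, which gives countable
compactness and forbids convergence in a Hausdorff space.  What has to be proved
is that [F] separates points, whence the topology is Hausdorff
([ex_admissible]).

The points [xi] belong to a maximal independent set, and [xi (f, b)] has a rank
above those of the points met in the supports of the values of [f]
([ex_accumulation_index]); ranks live in an order in which countable sets are
strictly bounded, like the first uncountable ordinal.  Given [x <> 0], let [D]
be a countable set of basis elements that contains the support of [x] and, with
each point [xi (f, b)], the supports of the values of [f].  The countably many
requirements at the points of [D] are met by a character [phi0] that is not near
0 at [x].  The others are met by adding to [phi0] a linear map that vanishes on
[D]: its value at a point [xi] outside [D] is dictated by the limit at [xi], and
this is a legitimate recursion on the rank.

The countable problem ([ex_limit_character]) has to be solved although the
ultrafilters are fixed beforehand.  The coordinates of [nat * nat] are a stage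
[n] and a position [i < len n].  At stage [n] a single requirement is treated,
with vectors [h n i = g n i - xi]; the stages of a requirement are the nodes of a
branch of the binary tree.  Two distinct branches have finitely many nodes in
common, so that countably many requirements get disjoint sets of stages once
each of them gives up finitely many ([ex_separating_levels]).  A vector of the stage is
kept if it has no small relation with those already kept.  The vectors of a
stage have no small relation among themselves, so that distinct vectors are
discarded on account of distinct combinations of the earlier vectors; as these
are at most [loss n] in number, at most [loss n] vectors are discarded
([few_skipped]).  The numbers [loss n] and [len n = n * loss n + 1] do not depend
on the group, and the sets that miss at most [c * loss n] positions at all late
stages of a branch form a proper filter ([branch_filter_proper]), which the
ultrafilter of the branch extends.

The kept vectors [v] can be sent simultaneously near 0, and [x] near 1/2, by a
character.  A generic linear functional reduces this to vectors that are
integers, the characters being those of [Z/N] for a large [N].  The product over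
the kept vectors of the Fejer kernels at the values of the character, a Riesz
product, has mean 1 because the absence of small relations kills all its
non-constant Fourier terms ([sum_riesz]).  The part of the mean carried by the
characters that fail at a given vector is at most a small number [eta], because
the Fejer kernel is at most [eta] away from the integers; if the sum of the
[eta] is below 1, some character fails nowhere ([riesz_point]).  An ultrafilter
limit of such characters deals with all stages. *)

(** * Real numbers modulo one, and the Fejer kernel *)

Section circle.
Variable R : realType.
Implicit Types (e x y : R).

Definition near_int e x := exists z : int, `|x - z%:~R| < e.

Lemma near_int0 e : 0 < e -> near_int e 0.
Proof. by move=> e0; exists 0; rewrite subr0 normr0. Qed.

Lemma near_intN e x : near_int e x -> near_int e (- x).
Proof.
by move=> [z hz]; exists (- z); rewrite mulrNz opprK addrC distrC.
Qed.

Lemma near_intD e1 e2 x y :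
  near_int e1 x -> near_int e2 y -> near_int (e1 + e2) (x + y).
Proof.
move=> [z hz] [w hw]; exists (z + w); rewrite intrD.
have -> : x + y - (z%:~R + w%:~R) = (x - z%:~R) + (y - w%:~R) by ring.
by apply: le_lt_trans (ler_normD _ _) _; exact: ltrD.
Qed.

Lemma near_intB e1 e2 x y :
  near_int e1 x -> near_int e2 y -> near_int (e1 + e2) (x - y).
Proof. by move=> hx hy; apply: near_intD => //; exact: near_intN. Qed.

Lemma near_intW e1 e2 x : e1 <= e2 -> near_int e1 x -> near_int e2 x.
Proof. by move=> h [z hz]; exists z; exact: lt_le_trans h. Qed.

Lemma near_int_norm e x : `|x| < e -> near_int e x.
Proof. by move=> h; exists 0; rewrite subr0. Qed.

Lemma near_intDz e x (z : int) : near_int e (x + z%:~R) <-> near_int e x.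
Proof.
split=> [[w h]|[w h]].
  by exists (w - z); rewrite intrB; congr (_ < e): h; congr (`|_|); ring.
by exists (w + z); rewrite intrD; congr (_ < e): h; congr (`|_|); ring.
Qed.

Definition turn_cos x : R := cos (x * (pi *+ 2)).
Definition turn_sin x : R := sin (x * (pi *+ 2)).
Local Notation tc := turn_cos.
Local Notation ts := turn_sin.

Lemma tc0 : tc 0 = 1. Proof. by rewrite /tc mul0r cos0. Qed.
Lemma tcN x : tc (- x) = tc x. Proof. by rewrite /tc mulNr cosN. Qed.
Lemma tcD x y : tc (x + y) = tc x * tc y - ts x * ts y.
Proof. by rewrite /tc /ts mulrDl cosD. Qed.
Lemma tsD x y : ts (x + y) = ts x * tc y + tc x * ts y.
Proof. by rewrite /tc /ts mulrDl sinD. Qed.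
Lemma tcB x y : tc (x - y) = tc x * tc y + ts x * ts y.
Proof. by rewrite /tc /ts mulrBl cosB. Qed.
Lemma tc2ts2 x : tc x ^+ 2 + ts x ^+ 2 = 1.
Proof. exact: cos2Dsin2. Qed.

Lemma tc1 : tc 1 = 1. Proof. by rewrite /tc mul1r cos2pi. Qed.
Lemma ts1 : ts 1 = 0. Proof. by rewrite /ts mul1r sin2pi. Qed.

Lemma tcDn x (n : nat) : tc (x + n%:R) = tc x.
Proof.
elim: n => [|n IH]; first by rewrite addr0.
by rewrite -natr1 addrA tcD tc1 ts1 mulr1 mulr0 subr0.
Qed.

Lemma tcDz x (z : int) : tc (x + z%:~R) = tc x.
Proof.
case: z => n; first exact: tcDn.
by rewrite NegzE mulrNz -[LHS](tcDn _ n.+1) subrK.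
Qed.

Lemma tcM x y : tc x * tc y = 2^-1 * (tc (x + y) + tc (x - y)).
Proof. by rewrite tcD tcB; field. Qed.

Lemma tc_lt1 e : 0 < e <= 2^-1 -> tc e < 1.
Proof.
move=> /andP[e0 e1]; rewrite -tc0 /tc.
have p0 := pi_gt0 R.
have h : e * (pi *+ 2) <= pi.
  by rewrite mulr2n; nra.
by rewrite ltr_cos ?in_itv/= ?mul0r ?lexx ?(ltW p0) ?h ?andbT//;
   [apply: mulr_gt0|apply: mulr_ge0; apply: ltW]=> //; rewrite pmulrn_lgt0.
Qed.

(** By periodicity and parity only [e <= x <= 1/2] has to be considered, where the
cosine decreases. *)
Lemma far_tc e x : 0 < e <= 2^-1 -> ~ near_int e x -> tc x <= tc e.
Proof.
move=> /andP[e0 e1] far.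
wlog x1 : x far / 0 <= x < 1.
  move=> hw; have := hw (x - (Num.floor x)%:~R).
  rewrite -mulrNz tcDz; apply; first by move/near_intDz.
  rewrite mulrNz subr_ge0 floor_le_tmp /=.
  by rewrite ltrBlDl -intrD1 floorD1_gt.
have p0 := pi_gt0 R.
wlog x2 : x far x1 / x <= 2^-1.
  move=> hw; have [|xl] := leP x (2^-1); first exact: hw.
  rewrite -(tcDz x (-1)) -tcN; apply: hw.
  - by move=> /near_intN; rewrite opprK => /near_intDz.
  - by rewrite opprD opprK /=; move/andP: x1 => [? ?]; apply/andP; split; lra.
  - by rewrite opprD opprK /=; lra.
have xe : e <= x.
  rewrite leNgt; apply/negP => xe; apply: far; exists 0; rewrite subr0 ger0_norm//.
  by case/andP: x1.
rewrite /tc leNgt ltr_cos -?leNgt ?in_itv /= ?mulr2n; last 2 first.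
  by case/andP: x1 => x0 _; apply/andP; split; nra.
  by apply/andP; split; nra.
by nra.
Qed.

End circle.

Section fejer.
Variable R : realType.
Implicit Types (e x y : R) (d : nat).
Local Notation tc := (@turn_cos R).
Local Notation ts := (@turn_sin R).

Definition fejer d x : R :=
  d.+1%:R^-1 * \sum_(j < d.+1) \sum_(k < d.+1) tc ((j%:R - k%:R) * x).

Let A d x := \sum_(j < d) tc (j%:R * x).
Let B d x := \sum_(j < d) ts (j%:R * x).

(** The double sum is the squared modulus of a geometric sum of [d + 1] unit
complex numbers, of which [A] and [B] are the real and imaginary parts. *)
Lemma fejerE d x : fejer d x = d.+1%:R^-1 * (A d.+1 x ^+ 2 + B d.+1 x ^+ 2).
Proof.
congr (_ * _); rewrite !expr2 /A /B !mulr_suml -big_split /=.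
apply: eq_bigr => j _; rewrite !mulr_sumr -big_split /=.
by apply: eq_bigr => k _; rewrite mulrBl tcB.
Qed.

Lemma fejer_ge0 d x : 0 <= fejer d x.
Proof. by rewrite fejerE mulr_ge0 ?invr_ge0// addr_ge0// sqr_ge0. Qed.

(** Real and imaginary parts of [(1 - z) * (1 + z + ... + z^(d-1)) = 1 - z^d], for
[z] of modulus 1. *)
Lemma geometric_tc d x :
  (1 - tc x) * A d x + ts x * B d x = 1 - tc (d%:R * x) /\
  (1 - tc x) * B d x - ts x * A d x = - ts (d%:R * x).
Proof.
rewrite /A /B; elim: d => [|d [IHA IHB]].
  by rewrite !big_ord0 !mul0r tc0 /turn_sin mul0r sin0; split; ring.
have E : d.+1%:R * x = d%:R * x + x by rewrite -natr1 mulrDl mul1r.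
rewrite !big_ord_recr /= E tcD tsD.
split.
  transitivity (1 - tc (d%:R * x) + ((1 - tc x) * tc (d%:R * x) + ts x * ts (d%:R * x))).
    by rewrite -IHA; ring.
  by ring.
transitivity (- ts (d%:R * x) + ((1 - tc x) * ts (d%:R * x) - ts x * tc (d%:R * x))).
  by rewrite -IHB; ring.
by ring.
Qed.

Lemma fejer_le d x : tc x < 1 -> fejer d x <= 2 / (d.+1%:R * (1 - tc x)).
Proof.
move=> x1; rewrite fejerE invfM mulrA [2 / _]mulrC -mulrA ler_wpM2l ?invr_ge0//.
have [h1 h2] := geometric_tc d.+1 x.
rewrite ler_pdivlMr ?subr_gt0//.
have c2 := tc2ts2 x; have c2' := tc2ts2 (d.+1%:R * x).
suff : 2 * ((A d.+1 x ^+ 2 + B d.+1 x ^+ 2) * (1 - tc x)) <= 4 by lra.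
have -> : 2 * ((A d.+1 x ^+ 2 + B d.+1 x ^+ 2) * (1 - tc x)) =
  (1 - tc (d.+1%:R * x)) ^+ 2 + (- ts (d.+1%:R * x)) ^+ 2.
  rewrite -h1 -h2.
  transitivity (((1 - tc x) ^+ 2 + (1 - tc x ^+ 2)) * (A d.+1 x ^+ 2 + B d.+1 x ^+ 2)).
    by ring.
  have -> : 1 - tc x ^+ 2 = ts x ^+ 2 by rewrite -c2; ring.
  by ring.
by nra.
Qed.

(** The mean of the kernel is 1 whatever [d], so that a small [eta] means that
almost all of its mass lies near the integers. *)
Definition concentrated d e (eta : R) :=
  forall x, ~ near_int e x -> fejer d x <= eta.

(** Away from the integers the geometric sum stays bounded, and the kernel
decreases like [1 / d]. *)
Lemma ex_concentrated e eta : 0 < e <= 2^-1 -> 0 < eta ->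
  exists d, concentrated d e eta.
Proof.
move=> e01 eta0; have e1 := tc_lt1 e01.
have dl : 0 < 1 - tc e by rewrite subr_gt0.
pose y := 2 / (eta * (1 - tc e)).
exists (Num.truncn y) => x far.
have xe := far_tc e01 far.
apply: le_trans (fejer_le _ (le_lt_trans xe e1)) _.
have yd : y < (Num.truncn y).+1%:R := truncnS_gt y.
rewrite ler_pdivrMr; last by rewrite mulr_gt0// subr_gt0 (le_lt_trans xe).
have : 2 <= eta * ((Num.truncn y).+1%:R * (1 - tc e)).
  rewrite mulrCA -ler_pdivrMr ?mulr_gt0//; exact: ltW.
move/le_trans; apply; rewrite ler_pM2l// ler_wpM2l//.
by rewrite lerD2l lerN2.
Qed.

(** Shifting the index by one leaves the sum unchanged and multiplies the
corresponding complex sum by [exp (2 i pi u / N)], which is not 1. *)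
Lemma sum_tc_eq0 (N : nat) (u : int) (b : R) :
  (0 < N)%N -> ~~ (N%:Z %| u)%Z ->
  \sum_(a < N) tc (u%:~R * a%:R / N%:R + b) = 0.
Proof.
move=> N0 Nu.
have NR : (N%:R : R) != 0 by rewrite pnatr_eq0 -lt0n.
pose h : R := u%:~R / N%:R.
have shift (f : R -> R) c : (forall x (z : int), f (x + z%:~R) = f x) ->
    \sum_(a < N) f (h * a%:R + (h + c)) = \sum_(a < N) f (h * a%:R + c).
  move=> per; move: N0 NR @h; case: (N) => // n _ NR h.
  rewrite big_ord_recr [RHS]big_ord_recl /= addrC; congr (_ + _).
    rewrite mulr0 add0r -[RHS](per _ u); congr f.
    have : h * n.+1%:R = u%:~R by rewrite divfK.
    by rewrite -natr1 => <-; ring.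
  by apply: eq_bigr => i _; rewrite /bump /= add1n -natr1; congr f; ring.
pose S c := \sum_(a < N) tc (h * a%:R + c).
pose S' c := \sum_(a < N) ts (h * a%:R + c).
(* The sine is a shifted cosine. *)
have tsDz x (z : int) : ts (x + z%:~R) = ts x.
  have e1 : ts x = - tc (x + 4^-1).
    rewrite /turn_sin /turn_cos.
    have -> : (x + 4^-1) * (pi *+ 2) = x * (pi *+ 2) + pi / 2 :> R.
      by rewrite mulr2n; field.
    by rewrite cosDpihalf opprK.
  have e2 : ts (x + z%:~R) = - tc (x + z%:~R + 4^-1).
    rewrite /turn_sin /turn_cos.
    have -> : (x + z%:~R + 4^-1) * (pi *+ 2) = (x + z%:~R) * (pi *+ 2) + pi / 2 :> R.
      by rewrite mulr2n; field.
    by rewrite cosDpihalf opprK.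
  by rewrite e1 e2 addrAC tcDz.
have h1 := shift tc b (@tcDz R); have h2 := shift ts b tsDz.
have E1 : \sum_(a < N) tc (h * a%:R + (h + b)) = tc h * S b - ts h * S' b.
  rewrite /S /S' !mulr_sumr -sumrB; apply: eq_bigr => i _.
  by rewrite addrCA tcD.
have E2 : \sum_(a < N) ts (h * a%:R + (h + b)) = ts h * S b + tc h * S' b.
  rewrite /S /S' !mulr_sumr -big_split; apply: eq_bigr => i _.
  by rewrite addrCA tsD.
have -> : \sum_(a < N) tc (u%:~R * a%:R / N%:R + b) = S b.
  by apply: eq_bigr => i _; rewrite /h mulrAC.
rewrite E1 -/(S b) in h1; rewrite E2 -/(S' b) in h2.
have c2 := tc2ts2 h.
(* The pair [(S b, S' b)] is fixed by a rotation of angle [2 * pi * h]. *)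
have : (2 - 2 * tc h) * S b = 0.
  transitivity ((1 - tc h) * (S b - (tc h * S b - ts h * S' b))
     - ts h * (S' b - (ts h * S b + tc h * S' b)) +
     (1 - (tc h ^+ 2 + ts h ^+ 2)) * S b); first by ring.
  by rewrite h1 h2 c2; ring.
move/eqP; rewrite mulf_eq0 => /orP[|/eqP//]; move=> /eqP th1; exfalso.
have N2 : (1 < N)%N.
  case: N N0 Nu {NR h S S' shift h1 h2 E1 E2 c2 th1} => [|[|n]]//.
  by rewrite dvd1z.
have eN : 0 < (N%:R^-1 : R) <= 2^-1.
  rewrite invr_gt0 ltr0n N0 /= lef_pV2 ?posrE ?ltr0n// ler_nat//.
have := far_tc eN (_ : ~ near_int N%:R^-1 h).
have := tc_lt1 eN.
move=> t1 /(_ _)/le_lt_trans /(_ t1) tt.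
suff : tc h < 1 by lra.
apply: tt => -[z].
have -> : h - z%:~R = (u - z * N%:Z)%:~R / N%:R.
  by rewrite intrB intrM /h; field.
rewrite normrM normfV (ger0_norm (ler0n _ _)) -ltr_pdivlMr ?invr_gt0 ?ltr0n//.
rewrite divff ?invr_eq0// -intr_norm -[1]/(1%:~R) ltr_int => zu.
have uz : u - z * N = 0 by lia.
by move: Nu; rewrite (_ : u = z * N) ?dvdz_mull//; lia.
Qed.

End fejer.

(** * Dissociated families and Riesz products *)

Definition symm_range (n : nat) : seq int := [seq k%:Z - n%:Z | k <- iota 0 (2 * n).+1].

Lemma mem_symm_range n (r : int) : (r \in symm_range n) = (`|r| <= n)%N.
Proof.
apply/mapP/idP => [[k]|h]; first by rewrite mem_iota => + ->; lia.
by exists (absz (r + n%:Z)); [rewrite mem_iota; lia|lia].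
Qed.

Lemma size_symm_range n : size (symm_range n) = (2 * n).+1.
Proof. by rewrite size_map size_iota. Qed.

Section combos.
Variables (I : eqType) (d : I -> nat) (V : zmodType) (v : I -> V).
Implicit Types (i : I) (l : seq I).

(** The frequencies that occur in a product over [l] of trigonometric polynomials
of degrees [d i] evaluated at the [v i]. *)
Fixpoint combos l : seq V :=
  if l is i :: l' then
    [seq v i *~ r + s | r <- symm_range (d i), s <- combos l']
  else [:: 0].

Definition free_over i l :=
  forall (r : int) s, r != 0 -> (`|r| <= d i)%N -> s \in combos l ->
  v i *~ r + s != 0.

(** The condition is sequential, and matches the factor-by-factor evaluation of
the mean of a Riesz product. *)
Fixpoint dissociated l : Prop :=
  if l is i :: l' then free_over i l' /\ dissociated l' else True.

Lemma combos_cons i l :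
  combos (i :: l) =
  [seq v i *~ r + s | r <- symm_range (d i), s <- combos l].
Proof. by []. Qed.

Lemma mem_combos_cons i l u :
  reflect (exists r s, [/\ (`|r| <= d i)%N, s \in combos l & u = v i *~ r + s])
          (u \in combos (i :: l)).
Proof.
apply: (iffP allpairsP) => [[[r s] /= [hr hs ->]]|[r [s [hr hs ->]]]].
  by exists r, s; rewrite -mem_symm_range.
by exists (r, s); rewrite /= mem_symm_range.
Qed.

Lemma size_combos_cons i l :
  size (combos (i :: l)) = ((2 * d i).+1 * size (combos l))%N.
Proof. by rewrite size_allpairs size_symm_range. Qed.

Lemma combosS i l : {subset combos l <= combos (i :: l)}.
Proof. by move=> u ul; apply/mem_combos_cons; exists 0, u; rewrite mulr0z add0r. Qed.

Lemma combos_rem i l : {subset combos (rem i l) <= combos l}.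
Proof.
elim: l => //= j l IH u; case: eqP => _; first exact: combosS.
move=> /mem_combos_cons[r [s [hr hs ->]]].
by apply/mem_combos_cons; exists r, s; split=> //; exact: IH.
Qed.

Lemma dissociated_rem i l : dissociated l -> dissociated (rem i l).
Proof.
elim: l => //= j l IH [jl dl]; case: eqP => _ //; split; last exact: IH.
by move=> r s r0 rd /combos_rem; exact: jl.
Qed.

End combos.

Section riesz_product.
Variables (R : realType) (I : eqType) (d : I -> nat) (v : I -> int).
Variables (t : I -> R) (N : nat).
Hypothesis N0 : (0 < N)%N.
Local Notation tc := (@turn_cos R).

Let phase i (a : nat) : R := (v i)%:~R * a%:R / N%:R - t i.

Definition riesz (l : seq I) (a : nat) : R := \prod_(i <- l) fejer (d i) (phase i a).

Lemma riesz_ge0 l a : 0 <= riesz l a.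
Proof. by apply: prodr_ge0 => i _; exact: fejer_ge0. Qed.

Lemma sum_riesz_cons i l (g : nat -> R) :
  \sum_(a < N) riesz (i :: l) a * g a =
  (d i).+1%:R^-1 * \sum_(j < (d i).+1) \sum_(k < (d i).+1)
     \sum_(a < N) riesz l a * (tc ((j%:R - k%:R) * phase i a) * g a).
Proof.
transitivity (\sum_(a < N) (d i).+1%:R^-1 * \sum_(j < (d i).+1) \sum_(k < (d i).+1)
     riesz l a * (tc ((j%:R - k%:R) * phase i a) * g a)).
  apply: eq_bigr => a _; rewrite /riesz big_cons -/(riesz l a) /fejer.
  rewrite -!mulrA; congr (_ * _); rewrite mulr_suml; apply: eq_bigr => j _.
  by rewrite mulr_suml; apply: eq_bigr => k _; ring.
rewrite -mulr_sumr; congr (_ * _); rewrite exchange_big; apply: eq_bigr => j _.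
by rewrite exchange_big.
Qed.

(** The frequencies of the Riesz product are the elements of [combos d v l], so
that the product has no Fourier coefficient at [u] modulo [N]. *)
Lemma sum_riesz_tc_eq0 l (u : int) (b : R) :
  (forall s, s \in combos d v l -> ~~ (N%:Z %| u + s)%Z) ->
  \sum_(a < N) riesz l a * tc (u%:~R * a%:R / N%:R + b) = 0.
Proof.
elim: l u b => [|i l IH] u b hu.
  rewrite -[RHS](@sum_tc_eq0 R N u b)//.
    by apply: eq_bigr => a _; rewrite /riesz big_nil mul1r.
  by have := hu 0; rewrite addr0 mem_head; apply.
rewrite (sum_riesz_cons _ _ (fun a => tc (u%:~R * a%:R / N%:R + b))).
rewrite big1 ?mulr0// => j _; rewrite big1// => k _.
pose r : int := j%:Z - k%:Z.
have rE : (j%:R - k%:R : R) = r%:~R by rewrite /r intrB !pmulrn.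
have rd : (`|r| <= d i)%N by rewrite /r; have := ltn_ord j; have := ltn_ord k; lia.
transitivity (2^-1 * (
   \sum_(a < N) riesz l a * tc ((u + v i *~ r)%:~R * a%:R / N%:R + (b - r%:~R * t i)) +
   \sum_(a < N) riesz l a * tc ((u + v i *~ (- r))%:~R * a%:R / N%:R + (b + r%:~R * t i)))).
  rewrite -big_split mulr_sumr; apply: eq_bigr => a _ /=.
  rewrite rE -mulrDr [RHS]mulrCA; congr (_ * _); rewrite [LHS]mulrC tcM.
  congr (_ * (tc _ + tc _)); rewrite /phase mulrzz intrD intrM ?intrN; ring.
rewrite !IH ?addr0 ?mulr0// => s sl.
  rewrite -addrA; apply: hu; apply/mem_combos_cons.
  by exists (- r), s; split=> //; rewrite abszN.
rewrite -addrA; apply: hu; apply/mem_combos_cons.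
by exists r, s; split=> //.
Qed.

(** Only the diagonal terms of the kernel of the first factor contribute: the
others are Fourier coefficients of the remaining product at nonzero multiples of
[v i], and vanish by dissociation. *)
Lemma sum_riesz l : dissociated d v l ->
  (forall s, s \in combos d v l -> (`|s| < N)%N) ->
  \sum_(a < N) riesz l a = N%:R.
Proof.
elim: l => [_ _|i l IH [il dl] sl].
  under eq_bigr do rewrite /riesz big_nil.
  by rewrite sumr_const card_ord.
have {}IH := IH dl (fun s h => sl s (combosS i h)).
transitivity (\sum_(a < N) riesz (i :: l) a * 1).
  by apply: eq_bigr => a _; rewrite mulr1.
rewrite (sum_riesz_cons _ _ (fun=> 1)).
transitivity ((d i).+1%:R^-1 * \sum_(j < (d i).+1) N%:R : R); last first.
  by rewrite sumr_const card_ord -[X in _ * X]mulr_natl mulKf// pnatr_eq0.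
congr (_ * _); apply: eq_bigr => j _.
rewrite (bigD1 j)//= [X in _ + X]big1 ?addr0 => [|k kj].
  rewrite -[RHS]IH; apply: eq_bigr => a _.
  by rewrite subrr mul0r tc0 !mulr1.
pose r : int := j%:Z - k%:Z.
have rE : (j%:R - k%:R : R) = r%:~R by rewrite /r intrB !pmulrn.
have rd : (`|r| <= d i)%N by rewrite /r; have := ltn_ord j; have := ltn_ord k; lia.
have r0 : r != 0.
  by apply: contra kj => /eqP r0; apply/eqP/val_inj => /=; rewrite /r in r0; lia.
rewrite -[RHS](@sum_riesz_tc_eq0 l (v i *~ r) (- (r%:~R * t i))).
  apply: eq_bigr => a _; rewrite mulr1 rE; congr (_ * tc _).
  by rewrite /phase mulrzz intrM; ring.
move=> s hs.
have h1 := il r s r0 rd hs.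
have h2 : (absz (v i *~ r + s : int) < N)%N.
  by apply: sl; apply/mem_combos_cons; exists r, s.
apply/negP => /dvdzP[q qE]; move: h1 h2; rewrite qE => h1.
have : q != 0 by apply: contra h1 => /eqP ->; rewrite mul0r.
by rewrite abszM => /=; nia.
Qed.

(** Union bound: replacing the kernel of [i] by [eta i] on the set of failures at
[i] leaves the Riesz product of the other vectors, whose mean is again 1. *)
Lemma riesz_point (e eta : I -> R) l : dissociated d v l ->
  (forall s, s \in combos d v l -> (`|s| < N)%N) ->
  (forall i, 0 <= eta i) ->
  (forall i, i \in l -> concentrated (d i) (e i) (eta i)) ->
  \sum_(i <- l) eta i < 1 ->
  exists a : nat, forall i, i \in l -> near_int (e i) (phase i a).
Proof.
move=> dl Nl eta0 cl eta1; apply: contrapT => /forallNP no.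
have {}no a : exists2 i, i \in l & ~ near_int (e i) (phase i a).
  by have /existsNP[i /not_implyP[il ni]] := no a; exists i.
pose bad i a := `[< ~ near_int (e i) (phase i a) >].
have : \sum_(a < N) riesz l a <= \sum_(i <- l) N%:R * eta i.
  apply: (@le_trans _ _ (\sum_(a < N) \sum_(i <- l | bad i a) riesz l a)).
    apply: ler_sum => a _; have [i il ni] := no a.
    rewrite (big_rem i)//= ifT; last exact/asboolP.
    by rewrite lerDl sumr_ge0// => j _; exact: riesz_ge0.
  under eq_bigr do rewrite big_mkcond /=.
  rewrite exchange_big /= big_seq [leRHS]big_seq; apply: ler_sum => i il.
  rewrite -big_mkcond /=.
  rewrite -(@sum_riesz (rem i l)) ?mulr_suml; last 2 first.
  - exact: dissociated_rem.
  - by move=> s /combos_rem; exact: Nl.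
  rewrite [leRHS](bigID (fun a : 'I_N => bad i a)) /=.
  apply: ler_wpDr.
    by apply: sumr_ge0 => a _; apply: mulr_ge0; [exact: riesz_ge0|].
  apply: ler_sum => a /asboolP ba.
  have -> : riesz l a = riesz (rem i l) a * fejer (d i) (phase i a).
    by rewrite /riesz (perm_big _ (perm_to_rem il)) big_cons mulrC.
  by apply: ler_wpM2l; [exact: riesz_ge0|exact: cl].
rewrite sum_riesz// -mulr_sumr -subr_ge0 -{2}[N%:R]mulr1 -mulrBr.
by rewrite pmulr_rge0 ?ltr0n// subr_ge0 leNgt eta1.
Qed.

End riesz_product.

(** * Coordinates on a torsion-free group *)

Lemma torsion_freez (G : zmodType) (x : G) (n : int) :
  torsion_free G -> n != 0 -> x *~ n = 0 -> x = 0.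
Proof.
move=> tf; case: n => n n0 h; first by apply: (tf x n); rewrite ?lt0n.
apply: (tf x n.+1) => //; apply/eqP; rewrite -oppr_eq0; apply/eqP.
by rewrite -h NegzE mulrNz.
Qed.

Section coordinates.
Variables (G : zmodType) (tfG : torsion_free G).
Implicit Types (B : set G) (x y b : G) (s : seq G) (m : G -> int) (w : G -> rat).

Definition lin_comb s m : G := \sum_(b <- s) b *~ m b.

Definition independent B := forall s m, uniq s -> (forall b, b \in s -> B b) ->
  lin_comb s m = 0 -> forall b, b \in s -> m b = 0.

Lemma lin_comb_widen s s' m : uniq s -> uniq s' -> {subset s <= s'} ->
  (forall b, b \notin s -> m b = 0) -> lin_comb s m = lin_comb s' m.
Proof.
move=> us us' ss' m0; rewrite /lin_comb [RHS](bigID (mem s))/= [X in _ + X]big1 ?addr0.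
  rewrite -[RHS]big_filter; apply: perm_big; apply: uniq_perm => //.
    exact: filter_uniq.
  by move=> b; rewrite mem_filter andb_idr//; exact: ss'.
by move=> b /m0 ->; rewrite mulr0z.
Qed.

(** [w] is the family of rational coordinates of [y] on [B]; a common denominator
[N] expresses this inside [G]. *)
Definition represents B y w := exists (N : nat) s m,
  [/\ (0 < N)%N, uniq s /\ (forall b, b \in s -> B b),
      forall b, b \notin s -> m b = 0,
      forall b, w b * N%:R = (m b)%:~R & y *+ N = lin_comb s m].

Lemma representsB B x y w w' : represents B x w -> represents B y w' ->
  represents B (x - y) (fun b => w b - w' b).
Proof.
move=> [N [s [m [N0 [us sB] m0 wm xE]]]] [N' [s' [m' [N'0 [us' sB'] m0' wm' yE]]]].
exists (N * N')%N, (undup (s ++ s')), (fun b => m b * N'%:Z - m' b * N%:Z).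
split.
- by rewrite muln_gt0 N0.
- split; first exact: undup_uniq.
  by move=> b; rewrite mem_undup mem_cat => /orP[/sB|/sB'].
- by move=> b; rewrite mem_undup mem_cat negb_or => /andP[/m0 -> /m0' ->]; rewrite !mul0r subrr.
- by move=> b; rewrite intrB !intrM -wm -wm' natrM; ring.
rewrite mulrnBl mulrnA [N in y *+ N]mulnC mulrnA xE yE.
rewrite (@lin_comb_widen s (undup (s ++ s')))//; last 2 first.
- exact: undup_uniq.
- by move=> b bs; rewrite mem_undup mem_cat bs.
rewrite (@lin_comb_widen s' (undup (s ++ s')))//; last 2 first.
- exact: undup_uniq.
- by move=> b bs; rewrite mem_undup mem_cat bs orbT.
rewrite /lin_comb -!sumrMnl -sumrB; apply: eq_bigr => b _.
by rewrite mulrzBr !mulrzA.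
Qed.

Lemma represents_uniq0 B w : independent B -> represents B 0 w -> forall b, w b = 0.
Proof.
move=> iB [N [s [m [N0 [us sB] m0 wm xE]]]] b.
have mb : m b = 0.
  have [bs|/m0//] := boolP (b \in s).
  by apply: (iB s m) => //; rewrite -xE mul0rn.
have /eqP := wm b; rewrite mb mulf_eq0 pnatr_eq0 => /orP[/eqP//|/eqP N00].
by rewrite N00 in N0.
Qed.

Lemma represents_inj B y w : represents B y w -> (forall b, w b = 0) -> y = 0.
Proof.
move=> [N [s [m [N0 _ _ wm xE]]]] w0; apply: (tfG N0).
rewrite xE /lin_comb big1// => b _.
have /esym/eqP := wm b; rewrite w0 mul0r intr_eq0 => /eqP ->.
by rewrite mulr0z.
Qed.

Lemma represents_basis B b : B b -> represents B b (fun c => (c == b)%:R).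
Proof.
move=> Bb; exists 1%N, [:: b], (fun c => (c == b)%:Z); split=> //.
- by split=> // c; rewrite inE => /eqP ->.
- by move=> c; rewrite inE => /negbTE ->.
- by move=> c; rewrite mulr1; case: eqP.
- by rewrite /lin_comb big_seq1 eqxx.
Qed.

Lemma represents_finite B y w : represents B y w ->
  finite_set [set b | w b != 0] /\ [set b | w b != 0] `<=` B.
Proof.
move=> [N [s [m [N0 [us sB] m0 wm _]]]].
have ws : [set b | w b != 0] `<=` [set` s].
  move=> b /= wb; have [//|/m0 mb] := boolP (b \in s).
  exfalso; move/negP: wb; apply.
  have /eqP := wm b; rewrite mb mulf_eq0 pnatr_eq0 => /orP[//|/eqP N00].
  by rewrite N00 in N0.
split; last by move=> b /ws /= /sB.
exact: sub_finite_set (finite_seq s).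
Qed.

Lemma ex_maximal_independent :
  exists B, independent B /\ forall B', B `<` B' -> ~ independent B'.
Proof.
apply: Zorn_bigcup => F Find Ftot s m us sF s0 b bs.
(* A finite part of the union of a chain lies in one member of the chain. *)
have [X FX sX] : exists2 X, F X & forall c, c \in s -> X c.
  have {us s0} := sF; elim: s b bs {m sF} => // a s IH b bs sF.
  have [X FX Xa] : (\bigcup_(X in F) X) a by apply: sF; rewrite mem_head.
  case: s IH {bs} sF => [|a' s] IH sF.
    by exists X => // c; rewrite inE => /eqP ->.
  have [|c cs|Y FY Ys] := IH a'; first by rewrite mem_head.
    by apply: sF; rewrite inE cs orbT.
  have [XY|YX] := Ftot _ _ FX FY.
    by exists Y => // c; rewrite inE => /orP[/eqP ->|/Ys]//; exact: XY.
  by exists X => // c; rewrite inE => /orP[/eqP ->|/Ys/YX].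
exact: (Find _ FX s m).
Qed.

(** These are the coordinates of the rational vector space spanned by [G], on a
maximal independent subset [B] of [G]. *)
Lemma ex_coordinates : exists B (kappa : G -> G -> rat),
  [/\ forall x y b, kappa (x - y) b = kappa x b - kappa y b,
      forall y, finite_set [set b | kappa y b != 0],
      forall y b, kappa y b != 0 -> B b,
      forall b c, B b -> kappa b c = (c == b)%:R &
      forall y, (forall b, kappa y b = 0) -> y = 0].
Proof.
have [B [iB maxB]] := ex_maximal_independent; exists B.
have ex_rep y : exists w, represents B y w.
  have [By|nBy] := pselect (B y); first by eexists; exact: represents_basis.
  have : ~ independent (B `|` [set y]).
    apply: maxB; split; first by move=> b Bb; left.
    by move=> /(_ y (or_intror erefl)).
  move=> /existsNP[s /existsNP[m /not_implyP[us /not_implyP[sB /not_implyP[s0]]]]].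
  move=> /existsNP[b /not_implyP[bs mb]].
  have split_y : y \in s -> lin_comb s m = y *~ m y + lin_comb (rem y s) m.
    by move=> ys; rewrite /lin_comb (big_rem y).
  have remB c : c \in rem y s -> B c.
    by rewrite mem_rem_uniq// inE => /andP[cy /sB[//|]] /= cy'; rewrite cy' eqxx in cy.
  (* Otherwise the relation would bear on [B] only. *)
  have ys : y \in s.
    apply/negP => ys; apply: mb; apply: (iB s m) => // c cs.
    by have [//|/= cy] := sB c cs; rewrite -cy cs in ys.
  have my : m y != 0.
    apply/eqP => my; apply: mb; have [->//|/eqP b_y] := eqVneq b y.
    apply: (iB (rem y s) m) => //; first exact: rem_uniq.
      by rewrite -s0 (split_y ys) my mulr0z add0r.
    by rewrite mem_rem_uniq// inE bs andbT; apply/eqP.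
  pose m' c := if c \in rem y s then - sgz (m y) * m c else 0.
  exists (fun c => (m' c)%:~R / `|m y|%:R); exists (absz (m y)), (rem y s), m'; split.
  - by rewrite absz_gt0.
  - by split; [exact: rem_uniq|].
  - by move=> c /negbTE cs; rewrite /m' cs.
  - by move=> c; rewrite divfK// pnatr_eq0 absz_eq0.
  have E : y *~ m y = - lin_comb (rem y s) m.
    by apply/eqP; rewrite -addr_eq0 -(split_y ys) s0.
  transitivity (y *~ (m y * sgz (m y))).
    by rewrite pmulrn abszEsg mulrC.
  rewrite mulrzA E mulNrz -mulrNz /lin_comb mulrz_suml.
  rewrite big_seq [RHS]big_seq; apply: eq_bigr => c cs.
  by rewrite /m' cs -mulrzA mulrC.
have [kappa rep] := choice ex_rep.
have kB x y b : kappa (x - y) b = kappa x b - kappa y b.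
  apply: subr0_eq; apply: (represents_uniq0
    (w := fun b => kappa (x - y) b - (kappa x b - kappa y b)) iB).
  rewrite -[X in represents _ X](subrr (x - y)).
  by apply: representsB; [exact: rep|exact: representsB].
exists kappa; split => //.
- by move=> y; have [] := represents_finite (rep y).
- by move=> y b; have [_] := represents_finite (rep y); apply.
- move=> b c Bb; apply: subr0_eq.
  apply: (represents_uniq0 (w := fun c => kappa b c - (c == b)%:R) iB).
  rewrite -[X in represents _ X](subrr b).
  by apply: representsB; [exact: rep|exact: represents_basis].
- by move=> y; exact: represents_inj.
Qed.

End coordinates.

(** * Riesz products on a torsion-free group *)

Section generic_functional.
Variables (G : zmodType) (kappa : G -> G -> rat).
Hypothesis kappaB : forall x y b, kappa (x - y) b = kappa x b - kappa y b.
Hypothesis kappa_inj : forall y, (forall b, kappa y b = 0) -> y = 0.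

Lemma ex_generic_shift (l : seq (rat * rat)) :
  (forall p, p \in l -> p != (0, 0)) ->
  exists c : nat, forall p, p \in l -> p.1 + c%:R * p.2 != 0.
Proof.
move=> l0; suff [K hK] : exists K, forall c : nat, (K <= c)%N ->
    forall p, p \in l -> p.1 + c%:R * p.2 != 0 by exists K; exact: hK.
elim: l l0 => [|[q r] l IH] l0; first by exists 0%N.
have [|K hK] := IH; first by move=> p pl; apply: l0; rewrite inE pl orbT.
exists (maxn K (Num.truncn `|q / r|).+1) => c; rewrite geq_max => /andP[Kc qc] p.
rewrite inE => /orP[/eqP -> /=|]; last exact: hK.
have [r0|r0] := eqVneq r 0.
  rewrite r0 mulr0 addr0; have := l0 (q, r) (mem_head _ _).
  by rewrite r0; apply: contra => /eqP ->.
apply/negP => /eqP/(canRL (addrK _)); rewrite sub0r => qE.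
have : `|q / r| < c%:R.
  by apply: lt_le_trans (truncnS_gt _) _; rewrite ler_nat.
by rewrite qE -mulNr mulfK// normrN ger0_norm ?ltxx.
Qed.

(** Each nonzero vector excludes at most one value of [c] in a combination
[lam + c * kappa b]. *)
Lemma ex_generic_functional (l : seq G) : (forall u, u \in l -> u != 0) ->
  exists2 lam : G -> rat, zmod_morphism lam & forall u, u \in l -> lam u != 0.
Proof.
elim: l => [_|u l IH l0]; first by exists (fun=> 0) => // x y; rewrite subr0.
have [|lam lamB lam0] := IH; first by move=> w wl; apply: l0; rewrite inE wl orbT.
have [b ub] : exists b, kappa u b != 0.
  apply: contrapT => /forallNP h; move/eqP: (l0 u (mem_head _ _)); apply.
  by apply: kappa_inj => b; have /negP := h b; rewrite negbK => /eqP.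
have [|c hc] := @ex_generic_shift [seq (lam w, kappa w b) | w <- u :: l].
  move=> _ /mapP[w + ->]; rewrite inE => /orP[/eqP ->|/lam0].
    by apply: contra ub => /eqP[_ ->].
  by apply: contra => /eqP[-> _].
exists (fun w => lam w + c%:R * kappa w b).
  by move=> x y /=; rewrite lamB kappaB; ring.
by move=> w wl; apply: (hc (lam w, kappa w b)); apply/mapP; exists w.
Qed.

End generic_functional.

Lemma common_denominator (l : seq rat) :
  exists2 Q : nat, (0 < Q)%N & forall q, q \in l -> exists z : int, q * Q%:R = z%:~R.
Proof.
elim: l => [|q l [Q Q0 hQ]]; first by exists 1%N.
have dq : (`|denq q|%N%:R : rat) = (denq q)%:~R.
  by rewrite pmulrn absz_denq.
exists (`|denq q| * Q)%N; first by rewrite muln_gt0 absz_gt0 denq_neq0.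
move=> q'; rewrite inE => /orP[/eqP ->|/hQ[z hz]].
  exists (numq q * Q%:Z); rewrite natrM dq mulrA intrM; congr (_ * _).
  by rewrite -[X in X * _]divq_num_den divfK// intr_eq0 denq_neq0.
by exists (denq q * z); rewrite natrM dq intrM -hz; ring.
Qed.

Section riesz_group.
Variables (R : realType) (G : zmodType) (kappa : G -> G -> rat).
Hypothesis kappaB : forall x y b, kappa (x - y) b = kappa x b - kappa y b.
Hypothesis kappa_inj : forall y, (forall b, kappa y b = 0) -> y = 0.

(** The conditions defining dissociation say that some elements of [combos d v l]
are nonzero; they pass to the image by [lam], which kills none of these. *)
Lemma dissociated_transfer (I : eqType) (d : I -> nat) (v : I -> G) (w : I -> int)
    (lam : G -> rat) (l : seq I) :
  zmod_morphism lam -> (forall i, i \in l -> lam (v i) = (w i)%:~R) ->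
  (forall u, u \in combos d v l -> u != 0 -> lam u != 0) ->
  dissociated d v l -> dissociated d w l.
Proof.
move=> lamB; pose f : {additive G -> rat} :=
  HB.pack lam (GRing.isZmodMorphism.Build _ _ lam lamB).
have fE x : lam x = f x by [].
have lift_combos l' s : (forall i, i \in l' -> lam (v i) = (w i)%:~R) ->
    s \in combos d w l' -> exists2 s', s' \in combos d v l' & lam s' = s%:~R.
  elim: l' s => [|i l' IH] s vw.
    by rewrite inE => /eqP ->; exists 0; rewrite ?mem_head// fE raddf0.
  move=> /mem_combos_cons[r [s1 [hr hs ->]]].
  have [|s2 hs2 s2E] := IH s1 _ hs; first by move=> j jl; apply: vw; rewrite inE jl orbT.
  exists (v i *~ r + s2); first by apply/mem_combos_cons; exists r, s2.
  by rewrite fE raddfD raddfMz -!fE s2E vw ?mem_head// mulrzz intrD intrM mulrzr.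
elim: l => //= i l IH vw gen [il dl]; split.
  move=> r s r0 rd hs.
  have [|s' hs' s'E] := lift_combos l s _ hs.
    by move=> j jl; apply: vw; rewrite inE jl orbT.
  have := gen (v i *~ r + s') _ (il r s' r0 rd hs').
  have mem : v i *~ r + s' \in combos d v (i :: l).
    by apply/mem_combos_cons; exists r, s'.
  move=> /(_ mem); apply: contra => /eqP h.
  rewrite fE raddfD raddfMz -!fE s'E vw ?mem_head// -[_ *~ r]mulrzr -intrM -mulrzz.
  by rewrite -intrD h.
apply: IH => //.
  by move=> j jl; apply: vw; rewrite inE jl orbT.
by move=> u ul; apply: gen; exact: combosS.
Qed.

(** A generic functional to the rationals, cleared of denominators, reduces the
problem to integers; the characters of [Z/N] then lift to additive maps to [R]. *)
Lemma riesz_group (I : eqType) (d : I -> nat) (v : I -> G) (t e eta : I -> R)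
    (l : seq I) :
  dissociated d v l -> (forall i, 0 <= eta i) ->
  (forall i, i \in l -> concentrated (d i) (e i) (eta i)) ->
  \sum_(i <- l) eta i < 1 ->
  exists2 phi : G -> R, zmod_morphism phi &
    forall i, i \in l -> near_int (e i) (phi (v i) - t i).
Proof.
move=> dl eta0 cl eta1.
have [|lam lamB lam0] := ex_generic_functional kappaB kappa_inj
   (l := [seq u <- combos d v l | u != 0]).
  by move=> u; rewrite mem_filter => /andP[].
have [Q Q0 hQ] := common_denominator [seq lam (v i) | i <- l].
have QR : (Q%:R : rat) != 0 by rewrite pnatr_eq0 -lt0n.
have [w hw] : exists w : I -> int, forall i, i \in l -> lam (v i) * Q%:R = (w i)%:~R.
  have /choice[w hw] : forall i, exists z : int, i \in l -> lam (v i) * Q%:R = z%:~R.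
    move=> i; have [il|nil] := boolP (i \in l); last by exists 0.
    by have [|z hz] := hQ (lam (v i)); [apply: map_f|exists z].
  by exists w.
have dw : dissociated d w l.
  apply: (@dissociated_transfer _ d v w (fun x => lam x * Q%:R)) => //.
    by move=> x y /=; rewrite lamB mulrBl.
  by move=> u ul u0; rewrite mulf_neq0// lam0// mem_filter u0.
pose N := (\sum_(s <- combos d w l) absz s).+1.
have hN s : s \in combos d w l -> (absz s < N)%N.
  by move=> sl; rewrite ltnS (big_rem s)//= leq_addr.
have [a ha] := @riesz_point R I d w t N (ltn0Sn _) e eta l dw hN eta0 cl eta1.
exists (fun y => ratr (lam y * Q%:R) * a%:R / N%:R).
  by move=> x y /=; rewrite lamB mulrBl raddfB /= !mulrBl.
by move=> i il; rewrite hw// ratr_int; exact: ha.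
Qed.

End riesz_group.

(** * Limits modulo one, and the selection of dissociated blocks *)

Lemma fmap_ultra (T U : Type) (f : T -> U) (F : set_system T) :
  UltraFilter F -> UltraFilter (fmap f F).
Proof.
move=> FU; split; first exact: fmap_proper_filter.
move=> H HF sFH; apply/seteqP; split=> [A HA|A FA]; last exact: sFH.
have [//|nA] := in_ultra_setVsetC (f @^-1` A) FU.
have HnA : H (~` A) by apply: sFH.
by have [y []] := filter_ex (filterI HA HnA).
Qed.

Section limits_mod_one.
Variable R : realType.

(** Congruence modulo the integers, in a form that passes to limits. *)
Definition eqmod1 (x y : R) := forall e : R, 0 < e -> near_int e (x - y).

Lemma ultra_limit_mod1 (T : Type) (p : set_system T) (u : T -> R) :
  UltraFilter p ->
  exists l : R, forall e : R, 0 < e -> p [set k | near_int e (u k - l)].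
Proof.
move=> up.
pose w k := u k - (Num.floor (u k))%:~R.
have wI k : [set` `[0, 1]%R] (w k).
    rewrite /w /= in_itv /= subr_ge0 floor_le_tmp /=.
  by rewrite lerBlDl ltW// -intrD1 floorD1_gt.
have cI : compact [set` `[(0 : R), 1]%R] by exact: segment_compact.
rewrite compact_ultra in cI; have [|l [_ hl]] := cI (w @ p) (fmap_ultra w up).
  have pT : p setT by exact: filterT.
  by apply: (@filterS _ p _ setT _ _ pT) => k _; exact: wI.
exists l => e e0.
have hb : p [set k | ball l e (w k)] := hl _ (nbhsx_ballx l e e0).
apply: filterS hb => k /=; rewrite /ball /= distrC => h.
apply/(near_intDz e _ (- Num.floor (u k))); apply: near_int_norm.
by rewrite mulrNz addrAC.
Qed.

Definition character (G : zmodType) (phi : G -> R) :=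
  forall x y, eqmod1 (phi (x - y)) (phi x - phi y).

End limits_mod_one.

(** Unlike [dissociated], this is a property of a whole sequence with one bound
on the coefficients, and it does not depend on the order. *)
Definition relation_free (G : zmodType) (D : nat) (h : nat -> G) :=
  forall (M : nat) (c : nat -> int), (forall j, (`|c j| <= D)%N) ->
  \sum_(j < M) h j *~ c j = 0 -> forall j, (j < M)%N -> c j = 0.

Lemma sum_ord_tail (V : nmodType) (i L : nat) (F : nat -> V) : (i < L)%N ->
  (forall j, (i < j)%N -> F j = 0) -> \sum_(j < L) F j = \sum_(j < i.+1) F j.
Proof.
move=> iL F0; rewrite -!(big_mkord xpredT F) (big_cat_nat _ iL)//=.
rewrite [X in _ + X](_ : _ = 0) ?addr0//.
by rewrite big_nat big1// => j /andP[ij _]; exact: F0.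
Qed.

Section greedy.
Variables (G : zmodType) (tfG : torsion_free G).
Variables (d0 : nat) (deg : nat -> nat -> nat).

(** [loss n] bounds the number of combinations of the vectors selected before
stage [n], whatever the group and the vectors. *)
Fixpoint loss n : nat :=
  if n is m.+1 then
    (((2 * deg m (m * loss m).+1).+1) ^ (m * loss m).+1 * loss m)%N
  else (2 * d0).+1.

Definition len n := (n * loss n).+1.
Definition degree n := deg n (len n).

Lemma loss_gt0 n : (0 < loss n)%N.
Proof. by elim: n => //= n IH; rewrite muln_gt0 IH expn_gt0. Qed.

Variables (x : G) (h : nat -> nat -> G).
Implicit Types (l old : seq (option (nat * nat))).

(** The index [None] stands for the vector [x] that has to be sent near 1/2, and
[Some (n, i)] for the vector at position [i] of stage [n]. *)
Definition node_degree (i : option (nat * nat)) :=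
  if i is Some p then degree p.1 else d0.
Definition node_vector (i : option (nat * nat)) :=
  if i is Some p then h p.1 p.2 else x.
Local Notation d := node_degree.
Local Notation v := node_vector.

Fixpoint extend n k old :=
  if k is i.+1 then
    let l := extend n i old in
    if `[< free_over d v (Some (n, i)) l >] then Some (n, i) :: l else l
  else old.

Fixpoint selection n :=
  if n is m.+1 then extend m (len m) (selection m) else [:: None].

Lemma extend_dissociated n k old :
  dissociated d v old -> dissociated d v (extend n k old).
Proof.
by move=> dl; elim: k => //= k IH; case: ifP => [/asboolP|//].
Qed.

Lemma selection_dissociated n : x != 0 -> dissociated d v (selection n).
Proof.
move=> x0; elim: n => [|n IH]; last exact: extend_dissociated.
split=> // r s r0 _; rewrite inE => /eqP ->; rewrite addr0.
by apply: contra x0 => /eqP h0; apply/eqP; exact: (torsion_freez tfG r0 h0).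
Qed.

Lemma size_combos_extend n k old :
  (size (combos d v (extend n k old)) <=
   (2 * degree n).+1 ^ k * size (combos d v old))%N.
Proof.
elim: k => [|k IH]; first by rewrite expn0 mul1n.
rewrite /=; case: ifP => _; rewrite expnS -mulnA.
  by rewrite size_combos_cons leq_mul2l IH orbT.
by apply: leq_trans IH _; rewrite leq_pmull.
Qed.

Lemma size_combos_selection n : (size (combos d v (selection n)) <= loss n)%N.
Proof.
elim: n => [|n IH]; first by rewrite /selection size_combos_cons muln1.
by apply: leq_trans (size_combos_extend _ _ _) _; rewrite leq_mul2l IH orbT.
Qed.

Lemma extend_sub n k old : {subset old <= extend n k old}.
Proof.
by move=> i il; elim: k => //= k IH; case: ifP => _ //; rewrite inE IH orbT.
Qed.

Lemma extend_sub_extend n j k old : (j <= k)%N ->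
  {subset extend n j old <= extend n k old}.
Proof.
move=> /subnKC <-; elim: (k - j)%N => [|m IH] i ij; first by rewrite addn0.
by rewrite addnS /=; case: ifP => _; rewrite ?inE IH ?orbT.
Qed.

Lemma selection_sub n m : (n <= m)%N -> {subset selection n <= selection m}.
Proof.
move=> /subnKC <-; elim: (m - n)%N => [|k IH] i ij; first by rewrite addn0.
by rewrite addnS; apply: extend_sub; exact: IH.
Qed.

Lemma combos_extend n k old s : s \in combos d v (extend n k old) ->
  exists s0 (c : nat -> int),
    [/\ s0 \in combos d v old, forall j, (`|c j| <= degree n)%N,
        forall j, (k <= j)%N -> c j = 0 & s = s0 + \sum_(j < k) h n j *~ c j].
Proof.
elim: k s => [|k IH] s.
  by move=> sl; exists s, (fun=> 0); split=> //; rewrite big_ord0 addr0.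
rewrite /=; case: ifP => _; last first.
  move=> /IH[s0 [c [h1 h2 h3 ->]]]; exists s0, c; split=> //.
    by move=> j kj; apply: h3; exact: ltnW.
  by rewrite big_ord_recr /= (h3 k)// mulr0z addr0.
move=> /mem_combos_cons[r [s1 [hr hs ->]]].
have [s0 [c [h1 h2 h3 ->]]] := IH _ hs.
exists s0, (fun j => if j == k then r else c j); split=> //.
- by move=> j; case: ifP.
- by move=> j kj; rewrite gtn_eqF//; apply: h3; exact: ltnW.
rewrite big_ord_recr /= eqxx [LHS]addrC -addrA; congr (_ + (_ + _)).
by apply: eq_bigr => j _; rewrite ltn_eqF.
Qed.

(** To each skipped vector corresponds a combination of the earlier stages that
cancels a combination of the vectors of this stage whose last nonzero coefficient
is at the skipped position.  If two skipped vectors had the same one, the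
difference would be a relation with coefficients at most [2 * degree n]. *)
Lemma few_skipped n : relation_free (2 * degree n) (h n) ->
  (count (fun i => Some (n, i) \notin selection n.+1) (iota 0 (len n)) <= loss n)%N.
Proof.
move=> rf; set old := selection n.
pose skip i := Some (n, i) \notin selection n.+1.
have skipP i : exists s0, (i < len n)%N && skip i ->
    s0 \in combos d v old /\ exists c : nat -> int,
    [/\ forall j, (`|c j| <= degree n)%N, c i != 0,
        forall j, (i < j)%N -> c j = 0 & s0 + \sum_(j < len n) h n j *~ c j = 0].
  have [/andP[iL si]|] := boolP ((i < len n)%N && skip i); last by exists 0.
  have : ~ free_over d v (Some (n, i)) (extend n i old).
    move=> fr; move/negP: si; apply; apply: (extend_sub_extend iL).
    by rewrite /= ifT ?mem_head//; exact/asboolP.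
  move=> /existsNP[r /existsNP[s /not_implyP[r0 /not_implyP[rd /not_implyP[hs]]]]].
  move=> /negP; rewrite negbK => /eqP rs.
  have [s0 [c [h1 h2 h3 sE]]] := combos_extend hs.
  exists s0 => _; split=> //; exists (fun j => if j == i then r else c j); split.
  - by move=> j; case: ifP.
  - by rewrite eqxx.
  - by move=> j ij; rewrite gtn_eqF//; apply: h3; exact: ltnW.
  rewrite (@sum_ord_tail _ i (len n) (fun j => h n j *~ (if j == i then r else c j)))//.
    rewrite big_ord_recr /= eqxx -[RHS]rs sE [RHS]addrC -addrA; congr (_ + (_ + _)).
    by apply: eq_bigr => j _; rewrite ltn_eqF.
  by move=> j ij; rewrite gtn_eqF// h3 ?mulr0z// ltnW.
have [sigma hsigma] := choice skipP.
rewrite -size_filter -(size_map sigma).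
apply: leq_trans (size_combos_selection n); apply: uniq_leq_size.
  rewrite map_inj_in_uniq ?filter_uniq ?iota_uniq// => i j.
  rewrite !mem_filter !mem_iota /= !add0n => /andP[si iL] /andP[sj jL].
  wlog ij : i j si iL sj jL / (i < j)%N.
    move=> hw sij; have [ij|ij|//] := ltngtP i j; first exact: hw.
    by apply/esym/hw.
  move=> sij; exfalso.
  have [|_ [c [c1 c2 c3 c4]]] := hsigma i; first by rewrite iL.
  have [|_ [c' [c'1 c'2 c'3 c'4]]] := hsigma j; first by rewrite jL.
  move/eqP: c'2; apply.
  have := rf (len n) (fun j => c' j - c j) _ _ j jL; rewrite c3// subr0; apply.
    by move=> k; have := c1 k; have := c'1 k; lia.
  under eq_bigr do rewrite mulrzBr.
  rewrite sumrB; apply/eqP; rewrite subr_eq0; apply/eqP.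
  by apply: (addrI (sigma i)); rewrite c4 sij c'4.
move=> _ /mapP[i + ->]; rewrite mem_filter mem_iota /= add0n => /andP[si iL].
by have [|] := hsigma i; first by rewrite iL.
Qed.
End greedy.

(** * A character nearly vanishing on almost all of every block *)

Section countable_case.
Variables (R : realType) (G : zmodType) (tfG : torsion_free G).
Variable kappa : G -> G -> rat.
Hypothesis kappaB : forall x y b, kappa (x - y) b = kappa x b - kappa y b.
Hypothesis kappa_inj : forall y, (forall b, kappa y b = 0) -> y = 0.
Variables (d0 : nat) (deg : nat -> nat -> nat).
Hypothesis d0P : concentrated d0 (4^-1 : R) (4^-1).
Hypothesis degP : forall n L, (0 < L)%N ->
  concentrated (deg n L) (n.+2%:R^-1 : R) (2 ^- n.+2 / L%:R).

Local Notation len := (len d0 deg).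
Local Notation loss := (loss d0 deg).
Local Notation degree := (degree d0 deg).
Local Notation node := (option (nat * nat)).

Variables (x : G) (h : nat -> nat -> G).
Hypothesis x0 : x != 0.

Local Notation selection := (selection d0 deg x h).

Let e (i : node) : R := if i is Some p then p.1.+2%:R^-1 else 4^-1.
Let t (i : node) : R := if i is Some p then 0 else 2^-1.
Let eta (i : node) : R := if i is Some p then 2 ^- p.1.+2 / (len p.1)%:R else 4^-1.

(** The tolerance [1/4] for [x] leaves room for a total of [1/2] for the stages,
that of stage [n] being [2 ^- (n + 2)]. *)
Lemma sum_eta n : \sum_(i <- selection n) eta i <= 4^-1 + (2^-1 - 2 ^- n.+1).
Proof.
elim: n => [|n IH]; first by rewrite big_seq1 expr1 subrr addr0.
have ext k : \sum_(i <- extend d0 deg x h n k (selection n)) eta i <=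
    \sum_(i <- selection n) eta i + k%:R * (2 ^- n.+2 / (len n)%:R).
  elim: k => [|k IHk]; first by rewrite mul0r addr0.
  have p0 : 0 <= 2 ^- n.+2 / (len n)%:R :> R by rewrite divr_ge0// invr_ge0 exprn_ge0.
  rewrite -natr1 /=; case: ifP => _; first by rewrite big_cons /=; lra.
  by lra.
apply: le_trans (ext _) _; rewrite mulrC divfK ?pnatr_eq0//.
have : 2 ^- n.+1 = 2 ^- n.+2 + 2 ^- n.+2 :> R.
  by rewrite [in RHS]exprS invfM -mulrDl; field; rewrite expf_neq0.
by lra.
Qed.

Lemma ex_finite_morphism n : exists2 phi : G -> R, zmod_morphism phi &
  forall i, i \in selection n -> near_int (e i) (phi (node_vector x h i) - t i).
Proof.
apply: (@riesz_group R G kappa kappaB kappa_inj _ (node_degree d0 deg)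
  (node_vector x h) t e eta).
- exact: selection_dissociated.
- by case=> [p|]; rewrite /eta ?divr_ge0 ?invr_ge0 ?exprn_ge0//.
- by case=> [p|] _; [exact: degP|exact: d0P].
- apply: le_lt_trans (sum_eta n) _.
  have : 0 < 2 ^- n.+1 :> R by rewrite invr_gt0 exprn_gt0.
  by lra.
Qed.

(** An ultrafilter limit, over [n], of the maps that suit the first [n] stages.
The limit costs a factor 2 in the precision. *)
Lemma ex_character : exists phi : G -> R,
  [/\ character phi, ~ near_int (8^-1) (phi x) &
   forall n, relation_free (2 * degree n) (h n) ->
   (count (fun i => ~~ `[< near_int (2 / n.+2%:R) (phi (h n i)) >])
     (iota 0 (len n)) <= loss n)%N].
Proof.
have /choice[Phi /all_and2[PhiB PhiP]] : forall n, exists phi : G -> R,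
    zmod_morphism phi /\
    forall i, i \in selection n -> near_int (e i) (phi (node_vector x h i) - t i).
  by move=> n; have [phi h1 h2] := ex_finite_morphism n; exists phi.
have [U [UU sU]] := ultraFilterLemma eventually_filter.
have /choice[phi phiP] : forall y, exists l : R, forall e : R, 0 < e ->
    U [set n | near_int e (Phi n y - l)].
  by move=> y; exact: ultra_limit_mod1.
have nodeP i m (dl : R) : i \in selection m -> 0 < dl ->
    near_int (e i + dl) (phi (node_vector x h i) - t i).
  move=> im dl0.
  have Um : U [set n | (m <= n)%N] by apply: sU; exact: nbhs_infty_ge.
  have [n [/= mn hn]] := filter_ex (filterI Um (phiP (node_vector x h i) _ dl0)).
  have h1 := PhiP n i (selection_sub mn im).
  rewrite (_ : _ - _ = (Phi n (node_vector x h i) - t i) -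
    (Phi n (node_vector x h i) - phi (node_vector x h i))); last by ring.
  exact: near_intB.
exists phi; split.
- move=> y z eps eps0; have eps3 : 0 < eps / 3 by rewrite divr_gt0.
  have [n [[/= h1 h2] h3]] := filter_ex (filterI (filterI
     (phiP (y - z) _ eps3) (phiP y _ eps3)) (phiP z _ eps3)).
  rewrite (_ : _ - _ = (Phi n y - phi y) - (Phi n z - phi z) -
    (Phi n (y - z) - phi (y - z))); last first.
    by rewrite PhiB; ring.
  have -> : eps = eps / 3 + eps / 3 + eps / 3 by field.
  by do 2![apply: near_intB => //].
- move=> [z zx].
  have [|z' z'x] := nodeP None 0%N (16^-1) (mem_head _ _); first by rewrite invr_gt0.
  move: zx z'x; rewrite /= /e /t => /ltr_normlP[h1 h2] /ltr_normlP[h3 h4].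
  have : (z - z')%:~R < 1 :> R by rewrite intrB; lra.
  have : 0 < (z - z')%:~R :> R by rewrite intrB; lra.
  by rewrite ltr0z -[1]/(1%:~R) ltr_int; lia.
- move=> n rf; apply: (leq_trans _ (@few_skipped _ d0 deg x h n rf)).
  apply: sub_count => i; apply: contra => isel; apply/asboolP.
  have := nodeP _ _ (n.+2%:R^-1) isel; rewrite /= /t subr0.
  have -> : 2 / n.+2%:R = n.+2%:R^-1 + n.+2%:R^-1 :> R by rewrite mulrDl mul1r.
  by apply; rewrite invr_gt0.
Qed.

End countable_case.

(** * Thinning of infinite sets, and ultrafilters attached to branches *)

Section thinning.
Variables (G : zmodType) (tfG : torsion_free G).

Lemma relation_freeW (D D' : nat) (h : nat -> G) : (D <= D')%N ->
  relation_free D' h -> relation_free D h.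
Proof. by move=> DD' rf M c cD; apply: rf => j; exact: leq_trans (cD j) DD'. Qed.

Lemma relation_free_inj (D : nat) (h : nat -> G) : (0 < D)%N ->
  relation_free D h -> injective h.
Proof.
move=> D0 rf i j hij; apply: contrapT => /eqP ij.
wlog lij : i j hij ij / (i < j)%N.
  move=> hw; have [lij|lij|/eqP] := ltngtP i j; last by rewrite (negbTE ij).
    exact: (hw i j).
  by apply: (hw j i) => //; rewrite eq_sym.
(* The relation [h j - h i = 0]. *)
pose c k : int := if k == j then 1 else if k == i then - 1 else 0.
have : c j = 0.
  apply: (rf j.+1 c) => // [k|].
    by rewrite /c; case: ifP => _ //; case: ifP.
  rewrite big_ord_recr /= {2}/c eqxx mulr1z.
  rewrite (bigD1 (Ordinal lij))//= big1 ?addr0.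
    by rewrite /c (ltn_eqF lij) eqxx mulrN1z -hij addNr.
  move=> k; rewrite -(inj_eq val_inj) /= => /negbTE ki.
  by rewrite /c (ltn_eqF (ltn_ord k)) ki mulr0z.
by rewrite /c eqxx.
Qed.

(** A relation [a *~ r + s = 0] with [r <> 0] determines [a] in a torsion-free
group, and there are finitely many pairs [(r, s)]. *)
Lemma ex_free_vector (A : set G) (D : nat) (l : seq G) : infinite_set A ->
  exists2 a, A a & free_over (fun=> D) id a l.
Proof.
move=> infA; apply: contrapT => no; apply: infA.
have bad a : exists p : int * G, A a ->
    [/\ p.1 \in symm_range D, p.2 \in combos (fun=> D) id l,
        p.1 != 0 & a *~ p.1 + p.2 = 0].
  have [Aa|] := pselect (A a); last by exists (0, 0).
  have : ~ free_over (fun=> D) id a l by move=> fr; apply: no; exists a.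
  move=> /existsNP[r /existsNP[s /not_implyP[r0 /not_implyP[rd /not_implyP[hs]]]]].
  move=> /negP; rewrite negbK => /eqP rs.
  by exists (r, s) => _; split; rewrite ?mem_symm_range.
have [f hf] := choice bad.
have finj : {in A &, injective f}.
  move=> a b /set_mem Aa /set_mem Ab fab.
  have [_ _ r0 ha] := hf a Aa; have [_ _ _ hb] := hf b Ab.
  apply: subr0_eq; apply: (torsion_freez tfG r0).
  rewrite mulrzBl; apply/eqP; rewrite subr_eq0; apply/eqP.
  by apply: (addIr (f a).2); rewrite ha fab hb.
rewrite -(eq_finite_set (inj_card_eq finj)).
apply: (@sub_finite_set _ _ ([set` symm_range D] `*` [set` combos (fun=> D) id l])).
  by move=> _ [a Aa <-]; have [? ? _ _] := hf a Aa; split.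
by apply: finite_setX; exact: finite_seq.
Qed.

(** Greedy choice.  The bound [D.+1] instead of [D] also excludes repetitions. *)
Lemma ex_relation_free (A : set G) (D : nat) : infinite_set A ->
  exists h : nat -> G, [/\ forall k, A (h k), injective h & relation_free D h].
Proof.
move=> infA.
have /choice[pick pickP] : forall l : seq G, exists a,
    A a /\ free_over (fun=> D.+1) id a l.
  by move=> l; have [a h1 h2] := ex_free_vector D.+1 l infA; exists a.
pose prefix k := iter k (fun l => pick l :: l) [::].
pose h k := pick (prefix k).
have mem_prefix M (c : nat -> int) : (forall j, (`|c j| <= D.+1)%N) ->
    \sum_(j < M) h j *~ c j \in combos (fun=> D.+1) id (prefix M).
  move=> cD; elim: M => [|M IH]; first by rewrite big_ord0 mem_head.
  rewrite big_ord_recr; apply/mem_combos_cons.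
  by exists (c M), (\sum_(j < M) h j *~ c j); rewrite addrC.
have rf : relation_free D.+1 h.
  move=> M c cD; elim: M => // M IH.
  have [_ fr] := pickP (prefix M).
  rewrite big_ord_recr /= => s0.
  have cM : c M = 0.
    apply: contrapT => /eqP cM.
    have := fr (c M) _ cM (cD M) (mem_prefix M c cD).
    by rewrite addrC s0 eqxx.
  move=> j; rewrite ltnS leq_eqVlt => /orP[/eqP ->//|]; apply: IH.
  by rewrite cM mulr0z addr0 in s0.
exists h; split.
- by move=> k; have [] := pickP (prefix k).
- exact: relation_free_inj rf.
- exact: relation_freeW rf.
Qed.

End thinning.

Lemma injective_nat_unbounded (f : nat -> nat) (K : nat) : injective f ->
  exists M, forall m, (M <= m)%N -> (K <= f m)%N.
Proof.
move=> finj; elim: K => [|K [M hM]]; first by exists 0%N.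
have [[m1 fm1]|no] := pselect (exists m, f m = K).
  exists (maxn M m1.+1) => m; rewrite geq_max => /andP[Mm m1m].
  rewrite ltn_neqAle hM// andbT; apply/eqP => fm.
  by move: m1m; rewrite (finj m m1) ?ltnn// -fm.
exists M => m Mm; rewrite ltn_neqAle hM// andbT.
by apply/eqP => fm; apply: no; exists m.
Qed.

Section branch_filters.
Variables (len loss : nat -> nat).
Hypothesis loss_gt0 : forall n, (0 < loss n)%N.
Hypothesis lenE : forall n, len n = (n * loss n).+1.
Implicit Types (y : nat -> bool) (X : set (nat * nat)).

(** The code of the node of level [m] on the branch [y] of the binary tree. *)
Definition node_code y (m : nat) : nat := pickle (mkseq y m).

Lemma node_code_eq y y' m m' : node_code y m = node_code y' m' ->
  m = m' /\ forall j, (j < m)%N -> y j = y' j.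
Proof.
move=> /(pcan_inj pickleK) E.
have mm : m = m' by rewrite -(size_mkseq y m) E size_mkseq.
split=> // j jm; rewrite -(nth_mkseq false y jm) E nth_mkseq// -mm//.
Qed.

Lemma node_code_inj y : injective (node_code y).
Proof. by move=> m m' /node_code_eq[]. Qed.

Definition missing X n : nat :=
  count (fun i => ~~ `[< X (n, i) >]) (iota 0 (len n)).

(** A set is large when it misses, at all late nodes of the branch, at most a
fixed multiple of what a selection may skip. *)
Definition branch_filter y : set_system (nat * nat) :=
  [set X | exists c M : nat, forall m, (M <= m)%N ->
    (missing X (node_code y m) <= c * loss (node_code y m))%N].

(** The empty set misses [len n], that is [n * loss n + 1], positions at stage
[n], which is more than [c * loss n] once [n >= c]. *)
Global Instance branch_filter_proper y : ProperFilter (branch_filter y).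
Proof.
split.
  move=> [c [M hM]].
  have [M' hM'] := injective_nat_unbounded c (@node_code_inj y).
  set m := maxn M M'.
  have := hM m (leq_maxl _ _); have := hM' m (leq_maxr _ _).
  set n := node_code y m; rewrite /missing (eq_count (a2 := predT)).
    rewrite count_predT size_iota lenE => cn.
    by apply/negP; rewrite -ltnNge ltnS leq_mul2r cn orbT.
  by move=> i /=; apply/negP => /asboolP.
split.
- exists 0%N, 0%N => m _; rewrite /missing (eq_count (a2 := pred0)) ?count_pred0//.
  by move=> i /=; apply/negbTE; rewrite negbK; apply/asboolP.
- move=> X Y [c [M hM]] [c' [M' hM']]; exists (c + c')%N, (maxn M M') => m.
  rewrite geq_max => /andP[Mm M'm]; rewrite mulnDl.
  apply: leq_trans (leq_add (hM m Mm) (hM' m M'm)).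
  rewrite /missing -count_predUI; apply: leq_trans (leq_addr _ _).
  apply: sub_count => i /=; rewrite -negb_and; apply: contra => /andP[/asboolP ? /asboolP ?].
  by apply/asboolP; split.
- move=> X Y XY [c [M hM]]; exists c, M => m Mm; apply: leq_trans (hM m Mm).
  apply: sub_count => i /=; apply: contra => /asboolP Xi; apply/asboolP; exact: XY.
Qed.

Lemma ex_branch_ultrafilter :
  exists p : (nat -> bool) -> set_system (nat * nat),
    forall y, UltraFilter (p y) /\ branch_filter y `<=` p y.
Proof.
have /choice[p pP] : forall y, exists q, UltraFilter q /\ branch_filter y `<=` q.
  by move=> y; exact: ultraFilterLemma.
by exists p.
Qed.

(** This is what makes an accumulation point out of a limit along an
ultrafilter: a set with boundedly many positions at every stage is negligible. *)
Lemma branch_filter_setC y X q :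
  (forall n, (count (fun i => `[< X (n, i) >]) (iota 0 (len n)) <= q)%N) ->
  branch_filter y (~` X).
Proof.
move=> hq; exists q, 0%N => m _; set n := node_code y m.
apply: (@leq_trans q); last by rewrite leq_pmulr.
apply: leq_trans (hq n); apply: sub_count => i /=; apply: contraR => nX.
by apply/asboolP => Xi; move/asboolP: nX.
Qed.

End branch_filters.

(** * Countably many prescribed limits *)

Section countable_limits.
Variables (R : realType) (G : zmodType) (tfG : torsion_free G).
Variable kappa : G -> G -> rat.
Hypothesis kappaB : forall x y b, kappa (x - y) b = kappa x b - kappa y b.
Hypothesis kappa_inj : forall y, (forall b, kappa y b = 0) -> y = 0.
Variables (d0 : nat) (deg : nat -> nat -> nat).
Hypothesis d0P : concentrated d0 (4^-1 : R) (4^-1).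
Hypothesis degP : forall n L, (0 < L)%N ->
  concentrated (deg n L) (n.+2%:R^-1 : R) (2 ^- n.+2 / L%:R).

Variables (C : Type) (D : set C) (y : C -> nat -> bool) (H : C -> nat -> nat -> G).
Hypothesis countD : countable D.
Hypothesis y_inj : injective y.
Hypothesis H_free : forall a n, D a -> relation_free (2 * degree d0 deg n) (H a n).

(** Enumerate [D]; beyond the level [M a], the branch of [a] has left the
branches of the finitely many earlier elements of [D]. *)
Lemma ex_separating_levels : exists M : C -> nat, forall a b m,
  D a -> D b -> (M a <= m)%N -> (M b <= m)%N ->
  (forall j, (j < m)%N -> y a j = y b j) -> a = b.
Proof.
have [e e_inj] := countable_injP _ countD.
have e_inj' a b : D a -> D b -> e a = e b -> a = b.
  by move=> Da Db; apply: e_inj; exact: mem_set.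
have /choice[M hM] : forall a, exists M : nat, forall b, D a -> D b -> (e b < e a)%N ->
    exists2 j, (j < M)%N & y a j <> y b j.
  move=> a; have [Da|nDa] := pselect (D a); last by exists 0%N.
  suff hK : forall K, (K <= e a)%N -> exists M : nat, forall b, D b -> (e b < K)%N ->
      exists2 j, (j < M)%N & y a j <> y b j.
    by have [M hM] := hK (e a) (leqnn _); exists M => b _; exact: hM.
  elim=> [_|K IH Ka]; first by exists 0%N.
  have [M hM] := IH (ltnW Ka).
  have [[b [Db eb]]|no] := pselect (exists b, D b /\ e b = K); last first.
    exists M => b Db; rewrite ltnS leq_eqVlt => /orP[/eqP eb|]; last exact: hM.
    by exfalso; apply: no; exists b.
  have [j jab] : exists j, y a j <> y b j.
    apply/existsNP => /funext/y_inj ab.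
    by move: Ka; rewrite -eb ab ltnn.
  exists (maxn M j.+1) => b' Db'; rewrite ltnS leq_eqVlt => /orP[/eqP eb'|lt'].
    by exists j; [rewrite leq_max ltnSn orbT|rewrite (e_inj' b' b)// eb'].
  by have [i iM iab] := hM b' Db' lt'; exists i => //; rewrite leq_max iM.
exists M => a b m Da Db am bm ab; apply: (e_inj' _ _ Da Db).
have [lt_ab|lt_ba|//] := ltngtP (e a) (e b).
  have [j jM jab] := hM b a Db Da lt_ab.
  by case: jab; rewrite ab// (leq_trans jM).
have [j jM jab] := hM a b Da Db lt_ba.
by case: jab; rewrite ab// (leq_trans jM).
Qed.

Local Notation len := (len d0 deg).
Local Notation loss := (loss d0 deg).

Variable p : (nat -> bool) -> set_system (nat * nat).
Hypothesis pU : forall z, UltraFilter (p z).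
Hypothesis pF : forall z, branch_filter len loss z `<=` p z.

(** Beyond the separating levels, a node lies on the branch of at most one
requirement, whose vectors are used at that stage. *)
Lemma ex_limit_character (x : G) : x != 0 -> exists phi : G -> R,
  [/\ character phi, ~ near_int (8^-1) (phi x) &
   forall a, D a -> forall e : R, 0 < e ->
     p (y a) [set k | near_int e (phi (H a k.1 k.2))]].
Proof.
move=> x0; have [M hM] := ex_separating_levels.
have /choice[h hh] : forall n, exists g : nat -> G, forall a m,
    D a -> (M a <= m)%N -> n = node_code (y a) m -> g = H a n.
  move=> n; have [[a [m [Da am nE]]]|no] :=
    pselect (exists a m, [/\ D a, (M a <= m)%N & n = node_code (y a) m]).
    exists (H a n) => b m' Db bm' nE'; congr (H _ n).
    have [mm' yab] := node_code_eq (etrans (esym nE) nE').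
    by subst m'; exact: (hM a b m).
  by exists (fun=> 0) => a m Da am nE; exfalso; apply: no; exists a, m.
have [phi [phiC phix phiP]] :=
  ex_character tfG kappaB kappa_inj d0P degP h x0.
exists phi; split=> // a Da e e0; apply: pF.
pose K := (Num.truncn (2 / e)).+1.
have [M' hM'] := injective_nat_unbounded K (@node_code_inj (y a)).
exists 1%N, (maxn (M a) M') => m; rewrite geq_max mul1n => /andP[Mm M'm].
have Kn := hM' m M'm; set n := node_code (y a) m in Kn *.
have hn : h n = H a n by apply: hh Mm _.
apply: leq_trans (phiP n _); last by rewrite hn; exact: H_free.
apply: sub_count => i /=; apply: contra => /asboolP ni; apply/asboolP.
rewrite hn in ni; apply: near_intW ni.
rewrite ler_pdivrMr ?ltr0n// mulrC -ler_pdivrMr//.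
apply: ltW; apply: lt_le_trans (truncnS_gt _) _; rewrite ler_nat.
by apply: leq_trans Kn _; rewrite -[leqLHS]addn0 -addn2 leq_add2l.
Qed.

End countable_limits.

(** * Pairings of infinite sets *)

Section squares.
Variable T : Type.
Implicit Types (A B D : set T).

Definition embeds A B := exists f : T -> T,
  (forall a, A a -> B (f a)) /\ (forall a b, A a -> A b -> f a = f b -> a = b).

(** A maximal partial injection exhausts one of the two sets. *)
Lemma embeds_total A B : embeds A B \/ embeds B A.
Proof.
pose matching (M : set (T * T)) :=
  (forall u, M u -> A u.1 /\ B u.2) /\
  (forall u w, M u -> M w -> u.1 = w.1 <-> u.2 = w.2).
have [M [[MAB Mfi] Mmax]] : exists M, matching M /\ forall M', M `<` M' -> ~ matching M'.
  apply: Zorn_bigcup => F Fm Ftot; split.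
    by move=> u [X FX Xu]; have [h _] := Fm _ FX; exact: h.
  move=> u w [X FX Xu] [Y FY Yw].
  have [XY|YX] := Ftot _ _ FX FY.
    by have [_ h] := Fm _ FY; apply: h => //; exact: XY.
  by have [_ h] := Fm _ FX; apply: h => //; exact: YX.
have [domA|ndomA] := pselect (forall a, A a -> exists b, M (a, b)).
  left; have /choice[f fM] : forall a, exists b, A a -> M (a, b).
    by move=> a; have [/domA[b Mb]|na] := pselect (A a); [exists b|exists a].
  exists f; split=> [a /fM/MAB[]//|a b /fM Ma /fM Mb ab].
  by have [_ h] := Mfi _ _ Ma Mb; exact: h.
have [domB|ndomB] := pselect (forall b, B b -> exists a, M (a, b)).
  right; have /choice[f fM] : forall b, exists a, B b -> M (a, b).
    by move=> b; have [/domB[a Ma]|nb] := pselect (B b); [exists a|exists b].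
  exists f; split=> [b /fM/MAB[]//|a b /fM Ma /fM Mb ab].
  by have [h _] := Mfi _ _ Ma Mb; exact: h.
have /existsNP[a /not_implyP[Aa na]] := ndomA.
have /existsNP[b /not_implyP[Bb nb]] := ndomB.
exfalso; apply: (Mmax (M `|` [set (a, b)])).
  split; first by move=> u Mu; left.
  by move=> /(_ (a, b) (or_intror erefl)) Mab; apply: na; exists b.
split; first by move=> u [/MAB//|->].
move=> [a1 b1] [a2 b2] [M1|[-> ->]] [M2|[-> ->]] //=; first exact: (Mfi _ _ M1 M2).
  split=> [E|E]; exfalso; first by apply: na; exists b1; rewrite -E.
  by apply: nb; exists a1; rewrite -E.
split=> [E|E]; exfalso; first by apply: na; exists b2; rewrite E.
by apply: nb; exists a2; rewrite E.
Qed.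

Definition pairing_on D (q : T -> T -> T) :=
  (forall a b, D a -> D b -> D (q a b)) /\
  (forall a b a' b', D a -> D b -> D a' -> D b' ->
     q a b = q a' b' -> a = a' /\ b = b').

Lemma infinite_injection D : infinite_set D ->
  exists e : nat -> T, injective e /\ forall n, D (e n).
Proof.
move=> /infiniteP/card_leP[f].
exists (fun n => set_val (f (SigSub (mem_set (I : [set: nat] n))))).
split=> [m n /val_inj E|n]; last by apply: set_mem; exact: valP.
by have /(congr1 val) := inj (mem_set I) (mem_set I) E.
Qed.

(** Two copies of [D] are encoded in [D] with one bit each, and the pair of bits is
absorbed by two more uses of the pairing. *)
Lemma pairing_double D q (code : T -> T * bool) D' : pairing_on D q -> infinite_set D ->
  (forall a, D' a -> D (code a).1) ->
  (forall a b, D' a -> D' b -> code a = code b -> a = b) ->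
  exists q' : T -> T -> T, (forall a b, D' a -> D' b -> D (q' a b)) /\
  (forall a b a' b', D' a -> D' b -> D' a' -> D' b' ->
     q' a b = q' a' b' -> a = a' /\ b = b').
Proof.
move=> [qD qinj] /infinite_injection[e [einj eD]] codeD codeinj.
exists (fun a b => q (q (code a).1 (code b).1) (e (2 * (code a).2 + (code b).2)%N)).
split=> [a b Da Db|a b a' b' Da Db Da' Db'].
  by apply: (qD _ _ _ (eD _)); apply: (qD); exact: codeD.
move=> /qinj[||||/qinj[||||h1 h2]]; try by [exact: codeD|exact: eD|apply: (qD); exact: codeD].
move=> /einj h3.
have [h4 h5] : (code a).2 = (code a').2 /\ (code b).2 = (code b').2.
  by move: h3; do 4!case: (_.2).
split; apply: codeinj => //; first by case: (code a) (code a') h1 h4 => [? ?] [? ?] /= -> ->.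
by case: (code b) (code b') h2 h5 => [? ?] [? ?] /= -> ->.
Qed.

(** Take a maximal infinite subset [D] of [A] with a pairing.  If the rest of [A]
embeds in [D], then [A] is encoded in two copies of [D]; otherwise the rest
contains a copy of [D], and the pairing extends to the union, against
maximality. *)
Theorem ex_pairing A : infinite_set A -> exists q, pairing_on A q.
Proof.
move=> infA.
pose dom (Q : set (T * T * T)) := [set a | exists b c, Q (a, b, c)].
pose good (Q : set (T * T * T)) := [/\
  forall a b c, Q (a, b, c) -> [/\ A a, dom Q b & dom Q c],
  forall a b, dom Q a -> dom Q b -> exists c, Q (a, b, c),
  forall a b c c', Q (a, b, c) -> Q (a, b, c') -> c = c',
  forall a b a' b' c, Q (a, b, c) -> Q (a', b', c) -> a = a' /\ b = b' &
  infinite_set (dom Q)].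
have good_graph D q : D `<=` A -> infinite_set D -> pairing_on D q ->
    good [set u | [/\ D u.1.1, D u.1.2 & u.2 = q u.1.1 u.1.2]].
  move=> DA infD [qD qinj].
  have domE : dom [set u | [/\ D u.1.1, D u.1.2 & u.2 = q u.1.1 u.1.2]] = D.
    apply/seteqP; split=> [a [b [c []]]//|a Da].
    by exists a, (q a a).
  rewrite /good domE; split=> //.
  - by move=> a b c [/= Da Db ->]; split; [exact: DA| |exact: qD].
  - by move=> a b Da Db; exists (q a b).
  - by move=> a b c c' [/= _ _ ->] [/= _ _ ->].
  - by move=> a b a' b' c [/= Da Db ->] [/= Da' Db'] /qinj[].
have [Q [Qgood Qmax]] : exists Q, (Q = set0 \/ good Q) /\
    forall Q', Q `<` Q' -> ~ (Q' = set0 \/ good Q').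
  apply: Zorn_bigcup => F Fgood Ftot.
  set U := \bigcup_(X in F) X.
  have [->|/set0P[u0 [X0 FX0 X0u]]] := eqVneq U set0; [by left|right].
  have Fg X u : F X -> X u -> good X.
    by move=> FX Xu; have [X00|//] := Fgood _ FX; rewrite X00 in Xu.
  have common u w : U u -> U w -> exists X, [/\ F X, good X, X u & X w].
    move=> [X FX Xu] [Y FY Yw]; have [XY|YX] := Ftot _ _ FX FY.
      by exists Y; split=> //; [exact: Fg FY Yw|exact: XY].
    by exists X; split=> //; [exact: Fg FX Xu|exact: YX].
  have domU X : F X -> dom X `<=` dom U.
    by move=> FX a [b [c Xabc]]; exists b, c, X.
  split.
  - move=> a b c Uabc; have [X [FX [gX _ _ _ _] Xabc _]] := common _ _ Uabc Uabc.
    by have [Aa Xb Xc] := gX _ _ _ Xabc; split=> //; exact: domU FX _ _.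
  - move=> a b [b1 [c1 U1]] [b2 [c2 U2]].
    have [X [FX [_ gX _ _ _] X1 X2]] := common _ _ U1 U2.
    have [||c Xc] := gX a b; [by exists b1, c1|by exists b2, c2|].
    by exists c, X.
  - move=> a b c c' U1 U2; have [X [_ [_ _ gX _ _] X1 X2]] := common _ _ U1 U2.
    exact: gX X1 X2.
  - move=> a b a' b' c U1 U2; have [X [_ [_ _ _ gX _] X1 X2]] := common _ _ U1 U2.
    exact: gX X1 X2.
  - have [_ _ _ _ inf] := Fg _ _ FX0 X0u.
    by apply: sub_infinite_set inf; exact: domU.
have {Qgood} Qgood : good Q.
  case: Qgood => // Q0; exfalso.
  have [e [einj eA]] := infinite_injection infA.
  pose D := range e.
  have infD : infinite_set D.
    move=> /finite_preimage-/(_ _ e); rewrite /D => h.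
    apply: infinite_nat; apply: sub_finite_set (h _); last by move=> m n _ _; exact: einj.
    by move=> n _; exists n.
  have /choice[ie ieE] : forall a, exists n, D a -> a = e n.
    by move=> a; have [[n _ <-]|na] := pselect (D a); [exists n|exists 0%N].
  pose q a b := e (pickle (ie a, ie b)).
  have hq : pairing_on D q.
    split=> [a b _ _|a b a' b' Da Db Da' Db' /einj/(pcan_inj pickleK)[h1 h2]].
      by exists (pickle (ie a, ie b)).
    by rewrite (ieE a Da) (ieE b Db) h1 h2 -!ieE.
  have DA : D `<=` A by move=> _ [n _ <-].
  apply: (Qmax _ _ (or_intror (good_graph D q DA infD hq))).
  rewrite Q0; split; first by move=> u [].
  have D0 : D (e 0%N) by exists 0%N.
  by move=> /(_ ((e 0%N, e 0%N), q (e 0%N) (e 0%N)))[].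
have [QA Qtot Qfun Qinj Qinf] := Qgood.
set D := dom Q in QA Qtot Qinf.
have DA : D `<=` A by move=> a [b [c /QA[]]].
have /choice[q2 q2Q] : forall u : T * T, exists c, D u.1 -> D u.2 -> Q (u.1, u.2, c).
  move=> [a b]; have [[Da Db]|nab] := pselect (D a /\ D b).
    by have [c Qc] := Qtot a b Da Db; exists c.
  by exists a => Da Db; exfalso; apply: nab.
pose q a b := q2 (a, b).
have qQ a b : D a -> D b -> Q (a, b, q a b) by move=> Da Db; exact: (q2Q (a, b)).
have hq : pairing_on D q.
  split=> [a b Da Db|a b a' b' Da Db Da' Db' E]; first by have [] := QA _ _ _ (qQ a b Da Db).
  apply: (Qinj a b a' b' (q a b)); first exact: qQ.
  by rewrite E; exact: qQ.
have [[j [jAD jinj]]|[j [jD jinj]]] := embeds_total (A `\` D) D.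
  (* The rest of [A] is the second copy of [D]. *)
  pose code a := if `[< D a >] then (a, false) else (j a, true).
  have [a Aa|a b Aa Ab|q' [q'D q'inj]] := @pairing_double D q code A hq Qinf.
  - by rewrite /code; case: asboolP => //= nDa; exact: jAD.
  - rewrite /code; case: asboolP => Da; case: asboolP => Db // []//.
    by apply: jinj.
  by exists q'; split=> // a b Aa Ab; apply: DA; exact: q'D.
exfalso.
(* Here [D] can be doubled inside [A]. *)
pose D' := D `|` [set j a | a in D].
have /choice[code codeP] : forall a, exists u : T * bool, D' a ->
    D u.1 /\ a = if u.2 then j u.1 else u.1.
  move=> a; have [[Da|[a' Da' <-]]|na] := pselect (D' a).
  - by exists (a, false).
  - by exists (a', true).
  - by exists (a, false).
have [a /codeP[]//|a b /codeP[_ {2}->] /codeP[_ {2}->] ->//|q1 [q1D q1inj]] :=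
  @pairing_double D q code D' hq Qinf.
pose q' a b := if `[< D a /\ D b >] then q a b else j (q1 a b).
have D'D a : D a -> D' a by left.
have jn a : D a -> ~ D (j a) by move=> /jD[].
have hq' : pairing_on D' q'.
  split=> [a b Da Db|a b a' b' Da Db Da' Db'].
    rewrite /q'; case: asboolP => [[Da1 Db1]|_]; first by left; exact: hq.1.
    by right; exists (q1 a b) => //; exact: q1D.
  rewrite /q'; case: asboolP => [[Da1 Db1]|_]; case: asboolP => [[Da1' Db1']|_].
  - exact: hq.2.
  - move=> E; exfalso; apply: (jn (q1 a' b')); first exact: q1D.
    by rewrite -E; exact: hq.1.
  - move=> E; exfalso; apply: (jn (q1 a b)); first exact: q1D.
    by rewrite E; exact: hq.1.
  - by move=> /jinj E; apply: q1inj => //; apply: E; exact: q1D.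
have D'A : D' `<=` A by move=> a [/DA//|[b /jD[Ab _] <-]].
have infD' : infinite_set D' by apply: sub_infinite_set Qinf.
apply: (Qmax _ _ (or_intror (good_graph D' q' D'A infD' hq'))).
split.
  move=> [[a b] c] Qabc /=; have [_ Db _] := QA _ _ _ Qabc.
  have Da : D a by exists b, c.
  split; [by left|by left|].
  rewrite /q' ifT; last exact/asboolP.
  by apply: Qfun Qabc _; exact: qQ.
have [a Da] := infinite_setN0 Qinf.
move=> sub; apply: (jn a Da); exists (j a), (q' (j a) (j a)).
by apply: sub; split=> //; right; exists a.
Qed.

End squares.

(** * A basis of cardinality continuum, and the choice of the accumulation points *)

Lemma countable_image (T U : Type) (A : set T) (f : T -> U) :
  countable A -> countable (f @` A).
Proof. by move=> cA; apply: sub_countable cA; exact: card_image_le. Qed.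

Lemma uncountable_powerset : ~ countable [set: set nat].
Proof.
move=> /countable_injP[f finj].
pose S : set nat := [set n | exists X : set nat, f X = n /\ ~ X n].
have fS X : f X = f S -> X = S by apply: finj; rewrite inE.
have SN : ~ S (f S) by move=> Sf; case: (Sf) => X [/fS -> ]; exact.
by apply: (SN); exists S.
Qed.

Section basis_embedding.
Variables (G : zmodType) (B : set G) (kappa : G -> G -> rat).
Hypothesis kappaB : forall x y b, kappa (x - y) b = kappa x b - kappa y b.
Hypothesis kappa_fin : forall y, finite_set [set b | kappa y b != 0].
Hypothesis kappa_supp : forall y b, kappa y b != 0 -> B b.
Hypothesis kappa_inj : forall y, (forall b, kappa y b = 0) -> y = 0.
Hypothesis uncountableG : ~ countable [set: G].

Lemma coordinates_inj x y : (forall b, kappa x b = kappa y b) -> x = y.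
Proof.
by move=> xy; apply: subr0_eq; apply: kappa_inj => b; rewrite kappaB xy subrr.
Qed.

Lemma ex_support_seq : exists s : G -> seq G, forall y,
  [set b | kappa y b != 0] = [set` s y].
Proof.
have /choice[s sE] : forall y, exists s : seq G, [set b | kappa y b != 0] = [set` s].
  by move=> y; apply/finite_seqP.
by exists s.
Qed.

Lemma support_coefficients_inj (s : G -> seq G) x y :
  (forall y, [set b | kappa y b != 0] = [set` s y]) -> s x = s y ->
  [seq kappa x b | b <- s x] = [seq kappa y b | b <- s y] -> x = y.
Proof.
move=> sE sxy cxy; apply: coordinates_inj => b.
have [bs|nbs] := boolP (b \in s x).
  by move: cxy; rewrite sxy => /eq_in_map -> //; rewrite -sxy.
have zero z : b \notin s z -> kappa z b = 0.
  move=> nbz; apply/eqP/negPn/negP => h; move/negP: nbz; apply.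
  by have : [set` s z] b by rewrite -sE.
by rewrite !zero// -sxy.
Qed.

Lemma basis_infinite : infinite_set B.
Proof.
move=> finB; apply: uncountableG.
have [s sE] := ex_support_seq.
have [e einj] := countable_injP _ (finite_set_countable finB).
apply/countable_injP.
exists (fun y => pickle ([seq e b | b <- s y], [seq kappa y b | b <- s y])).
move=> x y _ _ /(pcan_inj pickleK)[h1 h2].
apply: (support_coefficients_inj sE _ h2).
have sB z b : b \in s z -> B b.
  move=> bz; apply: (@kappa_supp z).
  by have : [set` s z] b by []; rewrite -sE.
move: h1 {h2}; elim: (s x) (s y) (sB x) (sB y) => [|a l IH] [|a' l']//= la la' [h1 h2].
congr (_ :: _); first by apply: einj h1; rewrite inE; [apply: la|apply: la'];
  rewrite mem_head.
by apply: IH h2 => b bl; [apply: la|apply: la']; rewrite inE bl orbT.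
Qed.

(** An element is determined by its support, a finite sequence in [B], and its
coordinates, a finite sequence of rationals.  The first is coded in [B] by
iterated pairing, and the second by an integer, hence by an element of an
infinite sequence in [B]. *)
Lemma ex_basis_embedding : exists f : G -> G, injective f /\ forall y, B (f y).
Proof.
have [s sE] := ex_support_seq.
have [e [einj eB]] := infinite_injection basis_infinite.
have [q [qB qinj]] := ex_pairing basis_infinite.
have sB z : {in s z, forall b, B b}.
  move=> b bz; apply: (@kappa_supp z).
  by have : [set` s z] b by []; rewrite -sE.
pose enc := foldr q (e 0%N).
have encB l : {in l, forall b, B b} -> B (enc l).
  elim: l => [_|a l IH la]; first exact: eB.
  apply: qB; first by apply: la; rewrite mem_head.
  by apply: IH => b bl; apply: la; rewrite inE bl orbT.
have encinj l l' : {in l, forall b, B b} -> {in l', forall b, B b} ->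
    size l = size l' -> enc l = enc l' -> l = l'.
  elim: l l' => [|a l IH] [|a' l']//= la la' [sl] E.
  have lB b : b \in l -> B b by move=> bl; apply: la; rewrite inE bl orbT.
  have l'B b : b \in l' -> B b by move=> bl; apply: la'; rewrite inE bl orbT.
  have [||||-> E'] := qinj _ _ _ _ _ _ _ _ E.
  - by apply: la; rewrite mem_head.
  - exact: encB.
  - by apply: la'; rewrite mem_head.
  - exact: encB.
  by congr (_ :: _); exact: IH.
pose co y := [seq kappa y b | b <- s y].
exists (fun y => q (e (pickle (co y))) (enc (s y))); split; last first.
  by move=> y; apply: qB; [exact: eB|apply: encB; exact: sB].
move=> x y E.
have [||||/einj/(pcan_inj pickleK) cxy sxy] := qinj _ _ _ _ _ _ _ _ E;
  try by [exact: eB|apply: encB; exact: sB].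
apply: (support_coefficients_inj sE _ cxy); apply: encinj => //; try exact: sB.
by rewrite -[LHS](size_map (kappa x)) -/(co x) cxy size_map.
Qed.

End basis_embedding.

(** In a well-ordering of [T], let [small] be the set of the elements with
countably many predecessors.  It is uncountable, for otherwise the least element
outside it would belong to it; hence it is not covered by the countably many
elements below those of a countable set. *)
Lemma ex_countably_directed (T : eqType) : ~ countable [set: T] ->
  exists (below : T -> T -> Prop) (small : set T), well_founded below /\
    forall A, A `<=` small -> countable A -> exists2 i, small i & forall a, A a -> below a i.
Proof.
move=> uncT; have [R wo] := wochoice.well_ordering_principle T.
pose below a b := ~ R b a.
have minP (A : set T) a : A a -> exists2 z, A z & forall b, A b -> R z b.
  move=> Aa; have [|z [[zA zmin] _]] := wo [pred b | `[< A b >]].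
    by exists a; apply/asboolP.
  exists z; first by apply/asboolP.
  by move=> b Ab; apply: zmin; apply/asboolP.
have Rxx a : R a a by have [z <- zmin] := minP [set a] a erefl; exact: zmin.
have Ranti a b : R a b -> R b a -> a = b.
  move=> ab ba; have [|z [_ zuniq]] := wo (pred2 a b).
    by exists a; rewrite inE eqxx.
  transitivity z; [apply/esym|]; apply: zuniq; split; rewrite ?inE ?eqxx ?orbT//.
    by move=> c; rewrite inE => /orP[] /eqP ->.
  by move=> c; rewrite inE => /orP[] /eqP ->.
pose small := [set y | countable [set z | below z y]].
have uncO : ~ countable small.
  move=> cO; have [t nOt] : exists t, ~ small t.
    apply: contrapT => /forallNP all; apply: uncT; apply: sub_countable cO.
    by apply: subset_card_le => t _; exact: contrapT (all t).
  have [z nOz zmin] := minP (~` small) t nOt.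
  apply: nOz; apply: sub_countable cO; apply: subset_card_le => y /= yz.
  by apply: contrapT => nOy; apply: yz; exact: zmin.
exists below, small; split.
  move=> a; apply: contrapT => nacc.
  have [z nz zmin] := minP [set a | ~ Acc below a] a nacc.
  by apply: nz; split=> y yz; apply: contrapT => ny; apply: yz; exact: zmin.
move=> A AO cA; apply: contrapT => no; apply: uncO.
have -> : small = \bigcup_(a in A) (small `&` [set i | R i a]).
  apply/seteqP; split=> [i Oi|i [a _ []//]].
  apply: contrapT => ni; apply: no; exists i => // a Aa Ria.
  by apply: ni; exists a.
apply: bigcup_countable => // a Aa.
have : countable ([set i | below i a] `|` [set a]).
  have -> : [set i | below i a] `|` [set a] =
      \bigcup_(b in [set: bool]) (if b then [set i | below i a] else [set a]).
    by apply/seteqP; split=> [i [h|h]|i [[] _ h]]; [exists true|exists false|left|right].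
  apply: bigcup_countable; first exact: countableP.
  by case=> _; [exact: AO|exact: countable1].
apply: sub_countable; apply: subset_card_le => i [_ /= Ria].
have [->|nia] := eqVneq i a; [by right|left].
by move=> Rai; move/eqP: nia; apply; exact: Ranti.
Qed.

Section accumulation_index.
Variables (G : zmodType) (B : set G) (kappa : G -> G -> rat).
Hypothesis kappaB : forall x y b, kappa (x - y) b = kappa x b - kappa y b.
Hypothesis kappa_fin : forall y, finite_set [set b | kappa y b != 0].
Hypothesis kappa_supp : forall y b, kappa y b != 0 -> B b.
Hypothesis kappa_inj : forall y, (forall b, kappa y b = 0) -> y = 0.
Hypothesis cardG : [set: G] #= [set: set nat].

Lemma continuum_uncountable : ~ countable [set: G].
Proof.
move=> cG; apply: uncountable_powerset; apply: sub_countable cG.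
by have := cardG; rewrite card_eq_le => /andP[].
Qed.

Lemma ex_continuum_bijection : exists (u : G -> set nat) (w : set nat -> G),
  cancel w u /\ injective u.
Proof.
have /card_set_bijP[u [_ uinj usurj]] := cardG.
have /choice[w wu] : forall X, exists x, u x = X.
  by move=> X; have [x _ <-] := usurj X I; exists x.
exists u, w; split=> [X|x y]; first exact: wu.
by apply: uinj; rewrite inE.
Qed.

Local Notation index := ((nat -> G) * bool)%type.

(** [unpickle] splits [nat] into countably many copies of itself, each of which
carries one component. *)
Lemma ex_continuum_code : exists code : G * index -> set nat, injective code.
Proof.
have [u [w [wu uinj]]] := ex_continuum_bijection.
(* The copy of index 0 carries the boolean, and the others the points of [G]. *)
pose piece (a : G * index) (n : nat) : set nat :=
  if n is n'.+1 then u (a.2.1 n') else u a.1.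
exists (fun a : G * index => [set m | if (unpickle m : option (nat * nat)) is Some (n, k) then
   (if n is n'.+1 then piece a n' k else is_true a.2.2) else False]).
move=> [x [f b]] [x' [f' b']] /seteqP[sub sub'].
have E n k : (if n is n'.+1 then piece (x, (f, b)) n' k else b) <->
             (if n is n'.+1 then piece (x', (f', b')) n' k else b').
  have := sub (pickle (n, k)); have := sub' (pickle (n, k)).
  by rewrite /= pickleK /= => h1 h2; split; [exact: h2|exact: h1].
have xx : x = x'.
  by apply: uinj; apply/seteqP; split=> k; have [h1 h2] := E 1%N k; [exact: h1|exact: h2].
have ff : f = f'.
  apply/funext => n; apply: uinj; apply/seteqP.
  by split=> k; have [h1 h2] := E n.+2 k; [exact: h1|exact: h2].
have bb : b = b' by apply/idP/idP; have [h1 h2] := E 0%N 0%N.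
by rewrite xx ff bb.
Qed.

Lemma ex_branch_index : exists y : index -> nat -> bool, injective y.
Proof.
have [code codeinj] := ex_continuum_code.
exists (fun c n => `[< code (0, c) n >]) => c c' E.
suff [->//] : (0 : G, c) = (0, c').
apply: codeinj; apply/seteqP; split=> n h; have := congr1 (@^~ n) E => /= En; apply/asboolP.
  by rewrite -En; exact/asboolP.
by rewrite En; exact/asboolP.
Qed.

(** The point [xi c] carries, by injectivity of [iota], the index [c] and a rank
from [ex_countably_directed], chosen above the ranks found in the countable
union of the supports of the values of [c.1].  The boolean component of the
index provides two points for each sequence. *)
Lemma ex_accumulation_index : exists (xi : index -> G) (below : index -> index -> Prop),
  [/\ well_founded below, injective xi, forall c, B (xi c) &
   forall c c' n, kappa (c.1 n) (xi c') != 0 -> below c' c].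
Proof.
have uncG := continuum_uncountable.
have [u [w [wu _]]] := ex_continuum_bijection.
have [code codeinj] := ex_continuum_code.
have [f [finj fB]] := ex_basis_embedding kappaB kappa_fin kappa_supp kappa_inj uncG.
pose iota a := f (w (code a)).
have iota_inj : injective iota by move=> a b /finj/(can_inj wu)/codeinj.
have [below [small [below_wf Obound]]] := (ex_countably_directed uncG).
have /choice[rank rankP] : forall c : index, exists i, small i /\
    forall i' c' n, small i' -> kappa (c.1 n) (iota (i', c')) != 0 -> below i' i.
  move=> c.
  pose A := [set i' | small i' /\ exists c' n, kappa (c.1 n) (iota (i', c')) != 0].
  have [||i Oi iA] := Obound A; first by move=> i [].
    pose S := \bigcup_(n in [set: nat]) [set b | kappa (c.1 n) b != 0].
    have cS : countable S.
      by apply: bigcup_countable => // n _; exact: finite_set_countable.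
    have /choice[g gP] : forall b, exists i : G, forall i' c', b = iota (i', c') -> i = i'.
      move=> b; have [[[i c'] bE]|nb] := pselect (exists a, b = iota a).
        by exists i => i1 c1; rewrite bE => /iota_inj[].
      by exists b => i' c' bE; exfalso; apply: nb; exists (i', c').
    apply: sub_countable (countable_image g cS); apply: subset_card_le.
    by move=> i' [_ [c' [n h]]]; exists (iota (i', c')); [exists n|exact: gP].
  by exists i; split=> // i' c' n Oi' h; apply: iA; split=> //; exists c', n.
exists (fun c => iota (rank c, c)), (fun c c' => below (rank c) (rank c')); split.
- move=> c; move: {2}(rank c) (erefl (rank c)) => i.
  elim/(well_founded_ind below_wf): i c => i IH c ci.
  by constructor=> c' c'c; apply: (IH (rank c')) => //; rewrite -ci.
- by move=> c c' /iota_inj[].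
- by move=> c; exact: fB.
- move=> c c' n; have [_ h] := rankP c; apply: h.
  by have [] := rankP c'.
Qed.

End accumulation_index.

(** * Extension to all prescribed limits *)

Lemma well_founded_recursion (C : Type) (below : C -> C -> Prop) (R : nmodType)
    (F : C -> (C -> R) -> R) : well_founded below ->
  (forall c V V', (forall c', below c' c -> V c' = V' c') -> F c V = F c V') ->
  exists V, forall c, V c = F c V.
Proof.
move=> wf Fext.
pose F' c (rec : forall c', below c' c -> R) :=
  F c (fun c' => if pselect (below c' c) is left h then rec c' h else 0).
exists (Fix wf (fun=> R) F') => c; rewrite Fix_eq.
  by apply: Fext => c' c'c; case: pselect.
by move=> c1 f g fg; apply: Fext => c' c'c; case: pselect.
Qed.

Section linear_extension.
Variables (R : realType) (G : zmodType) (B : set G) (kappa : G -> G -> rat).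
Hypothesis kappaB : forall x y b, kappa (x - y) b = kappa x b - kappa y b.
Hypothesis kappa_fin : forall y, finite_set [set b | kappa y b != 0].
Hypothesis kappa_basis : forall b c, B b -> kappa b c = (c == b)%:R.

(** The linear map with values [v] on the basis. *)
Definition extension (v : G -> R) (y : G) : R :=
  \sum_(b \in [set b | kappa y b != 0]) ratr (kappa y b) * v b.

Lemma extension_seq v y (r : seq G) : uniq r ->
  [set b | kappa y b != 0] `<=` [set` r] ->
  extension v y = \sum_(b <- r) ratr (kappa y b) * v b.
Proof.
move=> ur yr; rewrite /extension (fsbig_fwiden r)//.
by move=> b [_ /= /negP]; rewrite negbK => /eqP ->; rewrite rmorph0 mul0r.
Qed.

Lemma extensionB v : zmod_morphism (extension v).
Proof.
move=> x y.
have /finite_seqP[s sE] := kappa_fin x; have /finite_seqP[t tE] := kappa_fin y.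
pose r := undup (s ++ t).
have ur : uniq r by exact: undup_uniq.
have xr : [set b | kappa x b != 0] `<=` [set` r].
  by rewrite sE => b /= bs; rewrite mem_undup mem_cat bs.
have yr : [set b | kappa y b != 0] `<=` [set` r].
  by rewrite tE => b /= bs; rewrite mem_undup mem_cat bs orbT.
rewrite !(@extension_seq v _ r)//.
  by rewrite -sumrB; apply: eq_bigr => b _; rewrite kappaB raddfB /= mulrBl.
move=> b /=; rewrite kappaB => xyb.
have [kx|kx] := eqVneq (kappa x b) 0; last exact: xr.
by apply: yr => /=; apply: contra xyb => /eqP ->; rewrite kx subrr.
Qed.

Lemma extension_basis v b : B b -> extension v b = v b.
Proof.
move=> Bb; rewrite (@extension_seq v b [:: b])//.
  by rewrite big_seq1 kappa_basis// eqxx rmorph1 mul1r.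
move=> c /=; rewrite kappa_basis//; have [->|_] := eqVneq c b.
  by rewrite mem_head.
by rewrite eqxx.
Qed.

Lemma eq_extension v v' y : (forall b, kappa y b != 0 -> v b = v' b) ->
  extension v y = extension v' y.
Proof. by move=> vv'; apply: eq_fsbigr => b; rewrite inE => /= /vv' ->. Qed.

Lemma extension_eq0 v y : (forall b, kappa y b != 0 -> v b = 0) -> extension v y = 0.
Proof. by move=> v0; apply: fsbig1 => b /= /v0 ->; rewrite mulr0. Qed.

End linear_extension.

Section prescribed_limits.
Variables (R : realType) (G : zmodType) (tfG : torsion_free G).
Variables (B : set G) (kappa : G -> G -> rat).
Hypothesis kappaB : forall x y b, kappa (x - y) b = kappa x b - kappa y b.
Hypothesis kappa_fin : forall y, finite_set [set b | kappa y b != 0].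
Hypothesis kappa_basis : forall b c, B b -> kappa b c = (c == b)%:R.
Hypothesis kappa_inj : forall y, (forall b, kappa y b = 0) -> y = 0.
Variables (d0 : nat) (deg : nat -> nat -> nat).
Hypothesis d0P : concentrated d0 (4^-1 : R) (4^-1).
Hypothesis degP : forall n L, (0 < L)%N ->
  concentrated (deg n L) (n.+2%:R^-1 : R) (2 ^- n.+2 / L%:R).
Local Notation len := (len d0 deg).
Local Notation loss := (loss d0 deg).
Variable p : (nat -> bool) -> set_system (nat * nat).
Hypothesis pU : forall z, UltraFilter (p z).
Hypothesis pF : forall z, branch_filter len loss z `<=` p z.

Local Notation index := ((nat -> G) * bool)%type.
Variables (y : index -> nat -> bool) (xi : index -> G) (below : index -> index -> Prop).
Hypothesis y_inj : injective y.
Hypothesis below_wf : well_founded below.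
Hypothesis xi_inj : injective xi.
Hypothesis xiB : forall c, B (xi c).
Hypothesis xi_below : forall c c' n, kappa (c.1 n) (xi c') != 0 -> below c' c.

Variable g : index -> nat -> nat -> G.
Hypothesis g_range : forall c n i, infinite_set (range c.1) -> range c.1 (g c n i).
Hypothesis g_free : forall c n, infinite_set (range c.1) ->
  relation_free (2 * degree d0 deg n) (fun i => g c n i - xi c).

Definition admissible (phi : G -> R) := character phi /\
  forall c, infinite_set (range c.1) -> forall e : R, 0 < e ->
    p (y c) [set k | near_int e (phi (g c k.1 k.2) - phi (xi c))].

(** Solve the requirements at the points of a countable closed set [D], then add
an extension that vanishes on [D] and whose values at the other points are
obtained by recursion along [below]. *)
Lemma ex_admissible x : x != 0 ->
  exists2 phi, admissible phi & ~ near_int (8^-1) (phi x).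
Proof.
move=> x0.
(* [D] is the closure of the support of [x] under [next]. *)
pose next b := [set b' | exists c n, b = xi c /\ kappa (c.1 n) b' != 0].
have next_countable b : countable (next b).
  have [[c ->]|nb] := pselect (exists c, b = xi c); last first.
    apply: sub_countable (@countable0 G); apply: subset_card_le.
    by move=> b' [c [n [bE _]]]; apply: nb; exists c.
  apply: sub_countable (_ : countable (\bigcup_(n in [set: nat]) [set b' | kappa (c.1 n) b' != 0])).
    apply: subset_card_le => b' [c' [n [/xi_inj <- h]]].
    by exists n.
  by apply: bigcup_countable => // n _; exact: finite_set_countable.
pose stage k := iter k (fun S => \bigcup_(b in S) next b) [set b | kappa x b != 0].
pose D := \bigcup_(k in [set: nat]) stage k.
have D_countable : countable D.
  apply: bigcup_countable => // k _; elim: k => [|k IH] /=.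
    exact: finite_set_countable.
  by apply: bigcup_countable.
have D_next b b' : D b -> next b b' -> D b'.
  by move=> [k _ kb] bb'; exists k.+1 => //; exists b.
pose Dc := [set c | D (xi c) /\ infinite_set (range c.1)].
have Dc_countable : countable Dc.
  have [e einj] := countable_injP _ D_countable.
  apply/countable_injP; exists (e \o xi) => c c' /set_mem[Dx _] /set_mem[Dx' _] /= E.
  by apply: xi_inj; apply: einj => //; exact: mem_set.
have [phi0 [phi0C phi0x phi0P]] := @ex_limit_character R G tfG kappa kappaB kappa_inj
  d0 deg d0P degP index Dc y (fun c n i => g c n i - xi c) Dc_countable y_inj
  (fun c n hc => @g_free c n hc.2) p pF x x0.
have /choice[idx idxP] : forall b, exists i : option index,
    (forall c, b = xi c -> i = Some c) /\ (forall c, i = Some c -> b = xi c).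
  move=> b; have [[c ->]|nb] := pselect (exists c, b = xi c).
    by exists (Some c); split=> [c' /xi_inj ->//|c' [->]].
  by exists None; split=> // c bE; exfalso; apply: nb; exists c.
have idx_xi c : idx (xi c) = Some c by have [h _] := idxP (xi c); exact: h.
have /choice[plim plimP] : forall cu : index * (nat * nat -> R), exists l : R,
    forall e : R, 0 < e -> p (y cu.1) [set k | near_int e (cu.2 k - l)].
  by move=> [c u]; exact: ultra_limit_mod1.
pose value (V : index -> R) b : R :=
  if `[< D b >] then 0 else if idx b is Some c then V c else 0.
pose ext V := extension kappa (value V).
have g_supp c k b : infinite_set (range c.1) -> kappa (g c k.1 k.2) b != 0 ->
    exists n, kappa (c.1 n) b != 0.
  by move=> inf; have [n _ <-] := g_range k.1 k.2 inf; exists n.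
(* [V c] is the value at [xi c] that the requirement of [c] imposes; it only
   involves the values at points of the supports of [c.1], which are [below c]. *)
have [V VE] : exists V, forall c, V c = if `[< infinite_set (range c.1) >] then
    plim (c, fun k => phi0 (g c k.1 k.2) + ext V (g c k.1 k.2) - phi0 (xi c)) else 0.
  apply: (@well_founded_recursion _ below _ (fun c V =>
    if `[< infinite_set (range c.1) >] then
    plim (c, fun k => phi0 (g c k.1 k.2) + ext V (g c k.1 k.2) - phi0 (xi c)) else 0)) => //.
  move=> c V V' VV'; case: asboolP => // inf; congr (plim (c, _)).
  apply/funext => k; congr (_ + _ - _); apply: eq_extension => b /(g_supp _ _ _ inf)[n nb].
  rewrite /value; case: asboolP => // _; case E : (idx b) => [c'|//].
  apply: VV'; apply: (@xi_below _ _ n); have [_ h] := idxP b.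
  by rewrite -(h _ E).
have extB := extensionB kappaB kappa_fin (value V).
exists (fun z => phi0 z + ext V z); last first.
  rewrite /ext extension_eq0 ?addr0// => b xb; rewrite /value ifT//.
  by apply/asboolP; exists 0%N.
split.
  move=> z w e e0; have := phi0C z w e e0; congr near_int.
  by rewrite /ext extB; ring.
move=> c inf e e0; rewrite /ext (extension_basis kappa_basis)//.
(* For a point of [D], the added extension vanishes on everything involved. *)
have [Dxi|nDxi] := pselect (D (xi c)).
  have e2 : 0 < e / 2 by rewrite divr_gt0.
  apply: filterS (phi0P c (conj Dxi inf) _ e2) => k /= hk.
  rewrite extension_eq0; last first.
    move=> b /(g_supp _ _ _ inf)[n nb]; rewrite /value ifT//; apply/asboolP.
    by apply: D_next Dxi _; exists c, n.
  rewrite {1}/value ifT ?addr0; last exact/asboolP.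
  have := near_intB hk (phi0C (g c k.1 k.2) (xi c) _ e2).
  by rewrite -splitr; congr near_int; ring.
have vxi : value V (xi c) = V c by rewrite /value ifF ?idx_xi//; apply/asboolP.
have := plimP (c, fun k => phi0 (g c k.1 k.2) + ext V (g c k.1 k.2) - phi0 (xi c)) _ e0.
apply: filterS => k /=; rewrite vxi VE ifT; last exact/asboolP.
by congr near_int; rewrite /ext; ring.
Qed.

End prescribed_limits.

(** * The topology defined by a family of characters *)

Section countably_compact_criteria.
Variable T : topologicalType.

(** Infinitely many points of [A] near [a], and not just one other than [a]: no
separation axiom is then needed for countable compactness. *)
Definition accumulation_point (A : set T) (a : T) :=
  forall U, nbhs a U -> infinite_set (A `&` U).

(** Without a finite subcover, choose [f k] outside the first [k] members of the
cover.  Each member then contains [f k] for finitely many [k] only, whereas the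
one containing an accumulation point contains infinitely many values. *)
Lemma accumulation_countably_compact :
  (forall f : nat -> T, infinite_set (range f) -> exists a, accumulation_point (range f) a) ->
  countably_compact [set: T].
Proof.
move=> acc I D U /countable_injP[e einj] Uo Ucov; apply: contrapT => nofin.
have /choice[f fP] : forall k, exists x : T, forall i, D i -> (e i <= k)%N -> ~ U i x.
  move=> k; apply: contrapT => /forallNP nox; apply: nofin.
  pose S := [set i | D i /\ (e i <= k)%N].
  have finS : finite_set S.
    have inS : {in S &, injective e}.
      by move=> i j /set_mem[Di _] /set_mem[Dj _]; apply: einj; exact: mem_set.
    rewrite -(eq_finite_set (inj_card_eq inS)).
    apply: sub_finite_set (finite_seq (iota 0 k.+1)).
    by move=> _ [i [_ ik] <-]; rewrite /mkset mem_iota.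
  exists (fset_set S).
    by move=> i; rewrite in_fset_set// => /set_mem[Di _]; exact: mem_set.
  move=> x _; have /existsNP[i /not_implyP[Di /not_implyP[ik /contrapT Uix]]] := nox x.
  by exists i => //=; rewrite in_fset_set//; apply: mem_set; split.
have cov x : exists i, D i /\ U i x by have [i Di Uix] := Ucov x Logic.I; exists i.
have inff : infinite_set (range f).
  move=> /finite_seqP[s sE].
  suff [K hK] : exists K, forall x, x \in s -> exists i, [/\ D i, (e i <= K)%N & U i x].
    have fs : f K \in s by have : [set` s] (f K) by rewrite -sE; exists K.
    by have [i [Di iK Ui]] := hK _ fs; exact: (fP K i).
  elim: s {sE} => [|x s [K hK]]; first by exists 0%N.
  have [i [Di Ui]] := cov x; exists (maxn K (e i)) => z.
  rewrite inE => /orP[/eqP ->|/hK[j [Dj jK Uj]]].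
    by exists i; split=> //; exact: leq_maxr.
  by exists j; split=> //; rewrite leq_max jK.
have [a acca] := acc f inff; have [i [Di Ui]] := cov a.
apply: (acca (U i)); first by apply: open_nbhs_nbhs; split=> //; exact: Uo.
apply: sub_finite_set (finite_image f (finite_seq (iota 0 (e i)))).
move=> _ [[k _ <-] Uk]; exists k => //=; rewrite mem_iota /= ltnNge.
by apply/negP => ik; exact: (fP k i).
Qed.

(** One of the two accumulation points differs from the limit, and has a
neighbourhood that contains [u n] for finitely many [n] only; so the range is
finite, and a value other than the limit is taken finitely often. *)
Lemma accumulation_eventually_constant (u : nat -> T) (l : T) : hausdorff_space T ->
  (forall f : nat -> T, infinite_set (range f) ->
     exists a b, [/\ a <> b, accumulation_point (range f) a & accumulation_point (range f) b]) ->
  u @ \oo --> l -> eventually_constant u.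
Proof.
move=> hT acc ul.
have sep a : a <> l -> exists U V, [/\ nbhs a U, nbhs l V & U `&` V = set0].
  move=> al; apply: contrapT => no; apply: al; apply: hT => U V aU lV.
  by apply/set0P/eqP => UV; apply: no; exists U, V.
have ev V : nbhs l V -> exists N, forall n, (N <= n)%N -> V (u n).
  by move=> /ul[N _ hN]; exists N => n Nn; exact: hN.
have [inf|/contrapT fin] := pselect (infinite_set (range u)).
  exfalso.
  have far a : a <> l -> ~ accumulation_point (range u) a.
    move=> /sep[U [V [aU lV UV]]] /(_ U aU); apply.
    have [N hN] := ev V lV.
    apply: sub_finite_set (finite_image u (finite_seq (iota 0 N))).
    move=> _ [[k _ <-] Uk]; exists k => //=; rewrite mem_iota /= ltnNge.
    apply/negP => Nk; have : (U `&` V) (u k) by split=> //; exact: hN.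
    by rewrite UV.
  have [a [b [ab acca accb]]] := acc u inf.
  have [al|/far] := pselect (a = l); last exact.
  by apply: (far b) => // bl; apply: ab; rewrite al bl.
exists l; have /finite_seqP[s sE] := fin.
suff [N hN] : exists N, forall n, (N <= n)%N -> u n \in s -> u n = l.
  exists N => // n Nn; apply: hN => //.
  by have : [set` s] (u n) by rewrite -sE; exists n.
elim: s {sE} => [|a s [N hN]]; first by exists 0%N.
have [->|/eqP/sep[U [V [aU lV UV]]]] := eqVneq a l.
  by exists N => n Nn; rewrite inE => /orP[/eqP//|]; exact: hN.
have [N' hN'] := ev V lV; exists (maxn N N') => n.
rewrite geq_max => /andP[Nn N'n]; rewrite inE => /orP[/eqP una|]; last exact: hN.
have : (U `&` V) a by split; [exact: nbhs_singleton|rewrite -una; exact: hN'].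
by rewrite UV.
Qed.

End countably_compact_criteria.

(** [F] is a parameter of the type so that the topology can be found from it. *)
Definition character_space (R : realType) (G : zmodType) (F : set (G -> R)) : Type := G.

Section character_topology.
Variables (R : realType) (G : zmodType) (F : set (G -> R)).

Definition character_ball (s : seq (G -> R)) (e : R) (x : G) : set G :=
  [set z | forall phi, List.In phi s -> near_int e (phi z - phi x)].

HB.instance Definition _ := Choice.copy (character_space F) G.

Definition character_nbhs (x : (character_space F)) : set_system (character_space F) :=
  [set A | exists s e, [/\ 0 < e, forall phi, List.In phi s -> F phi &
                         character_ball s e x `<=` A]].

HB.instance Definition _ := hasNbhs.Build (character_space F) character_nbhs.

Lemma character_ball_center s e x : 0 < e -> character_ball s e x x.
Proof. by move=> e0 phi _; rewrite subrr; exact: near_int0. Qed.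

Fact character_nbhs_filter (x : (character_space F)) : ProperFilter (nbhs x).
Proof.
split; first by move=> [s [e [e0 _ sub]]]; have := sub x (character_ball_center x e0).
split.
- by exists [::], 1; split.
- move=> A A' [s [e [e0 sF sA]]] [s' [e' [e'0 s'F sA']]].
  exists (app s s'), (Num.min e e'); split.
  + by rewrite lt_min e0.
  + by move=> phi hphi; have [/sF|/s'F] := List.in_app_or _ _ _ hphi.
  + move=> z hz; split; [apply: sA|apply: sA'] => phi hphi.
      apply: (near_intW _ (hz _ _)); first by rewrite ge_min lexx.
      by apply/List.in_or_app; left.
    apply: (near_intW _ (hz _ _)); first by rewrite ge_min lexx orbT.
    by apply/List.in_or_app; right.
- by move=> A A' AA' [s [e [e0 sF sA]]]; exists s, e; split=> // z /sA/AA'.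
Qed.

Fact character_nbhs_singleton (x : (character_space F)) (A : set (character_space F)) :
  nbhs x A -> A x.
Proof. by move=> [s [e [e0 _]]]; apply; exact: character_ball_center. Qed.

Fact character_nbhs_nbhs (x : (character_space F)) (A : set (character_space F)) :
  nbhs x A -> nbhs x (nbhs^~ A).
Proof.
move=> [s [e [e0 sF sA]]]; have e2 : 0 < e / 2 by rewrite divr_gt0.
exists s, (e / 2); split=> // z hz; exists s, (e / 2); split=> // w hw.
apply: sA => phi hphi; have := near_intD (hw phi hphi) (hz phi hphi).
by rewrite -splitr addrA subrK.
Qed.

HB.instance Definition _ := Nbhs_isNbhsTopological.Build (character_space F)
  character_nbhs_filter character_nbhs_singleton character_nbhs_nbhs.

Hypothesis F_char : forall phi, F phi -> character phi.

(** The inequality in [near_int] is strict, which leaves room for an arbitrarily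
small error. *)
Lemma near_int_eqmod1 (e x y : R) : eqmod1 x y -> near_int e y -> near_int e x.
Proof.
move=> xy [z hz]; have d0 : 0 < e - `|y - z%:~R| by rewrite subr_gt0.
have [w hw] := xy _ d0; exists (z + w); rewrite intrD.
rewrite (_ : _ - _ = (x - y - w%:~R) + (y - z%:~R)); last by ring.
by apply: le_lt_trans (ler_normD _ _) _; rewrite -ltrBrDr.
Qed.

Lemma eqmod1_trans (x y z : R) : eqmod1 x y -> eqmod1 y z -> eqmod1 x z.
Proof.
move=> xy yz e e0; have e2 : 0 < e / 2 by rewrite divr_gt0.
by have := near_intD (xy _ e2) (yz _ e2); rewrite -splitr addrA subrK.
Qed.

Lemma eqmod1D (x y x' y' : R) : eqmod1 x x' -> eqmod1 y y' -> eqmod1 (x + y) (x' + y').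
Proof.
move=> xx yy e e0; have e2 : 0 < e / 2 by rewrite divr_gt0.
have := near_intD (xx _ e2) (yy _ e2); rewrite -splitr.
by congr near_int; ring.
Qed.

Lemma eqmod1N (x x' : R) : eqmod1 x x' -> eqmod1 (- x) (- x').
Proof. by move=> xx e e0; have := near_intN (xx _ e0); rewrite opprB opprK addrC. Qed.

Lemma eqmod1_refl (x : R) : eqmod1 x x.
Proof. by move=> e e0; rewrite subrr; exact: near_int0. Qed.

Lemma characterN (phi : G -> R) x : character phi -> eqmod1 (phi (- x)) (- phi x).
Proof.
move=> phiC; have := phiC 0 0; have := phiC 0 x; rewrite subr0 !sub0r subrr => h1 h2.
by apply: eqmod1_trans h1 _; rewrite -[X in eqmod1 _ X]sub0r; exact: eqmod1D (eqmod1_refl _).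
Qed.

Lemma characterD (phi : G -> R) x y : character phi -> eqmod1 (phi (x + y)) (phi x + phi y).
Proof.
move=> phiC; have := phiC x (- y); rewrite opprK => h; apply: eqmod1_trans h _.
apply: eqmod1D; first exact: eqmod1_refl.
by have := eqmod1N (characterN y phiC); rewrite opprK.
Qed.

Lemma character_topology_group : group_topology (Topological.class (character_space F)).
Proof.
split=> [[x y]|x] A [s [e [e0 sF sA]]].
  have e2 : 0 < e / 2 by rewrite divr_gt0.
  exists (character_ball s (e / 2) x, character_ball s (e / 2) y).
    by split; exists s, (e / 2); split.
  move=> [z w] [/= hz hw]; apply: sA => phi hphi; have phiC := F_char (sF _ hphi).
  have := near_intD (hz phi hphi) (hw phi hphi); rewrite -splitr.
  apply: near_int_eqmod1.
  have := eqmod1D (characterD z w phiC) (eqmod1N (characterD x y phiC)).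
  by congr eqmod1; ring.
exists s, e; split=> // z hz; apply: sA => phi hphi; have phiC := F_char (sF _ hphi).
have := near_intN (hz phi hphi); apply: near_int_eqmod1.
have := eqmod1D (characterN z phiC) (eqmod1N (characterN x phiC)).
by congr eqmod1; ring.
Qed.

Lemma character_topology_hausdorff :
  (forall x, x != 0 -> exists2 phi, F phi & ~ near_int (8^-1) (phi x)) ->
  hausdorff_space (character_space F).
Proof.
move=> sep x y xy; apply: contrapT => /eqP; rewrite -subr_eq0 => /sep[phi Fphi far].
have e0 : 0 < 16^-1 :> R by rewrite invr_gt0.
have ballP z : nbhs (z : (character_space F)) (character_ball [:: phi] 16^-1 z).
  by exists [:: phi], 16^-1; split=> // psi [<-|].
have [z [zx zy]] := xy _ _ (ballP x) (ballP y).
apply: far; apply: near_int_eqmod1 (F_char Fphi x y) _.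
have := near_intB (zy phi (or_introl erefl)) (zx phi (or_introl erefl)).
have -> : 16^-1 + 16^-1 = 8^-1 :> R by lra.
by congr near_int; ring.
Qed.

End character_topology.

(** * The family of characters, and the theorem *)

(** Thinning is applied to the translate [A - a]. *)
Lemma ex_thinned_sequence (G : zmodType) (A : set G) (a : G) (D : nat) :
  torsion_free G -> infinite_set A -> exists h : nat -> G,
  [/\ forall i, A (h i), injective h & relation_free D (fun i => h i - a)].
Proof.
move=> tfG infA.
have infA' : infinite_set ((fun x => x - a) @` A).
  move=> /(finite_image (fun x => x + a)); apply: contra_not infA.
  by apply: sub_finite_set => x Ax; exists (x - a); [exists x|rewrite subrK].
have [h [hA hinj hfree]] := ex_relation_free tfG D infA'.
exists (fun i => h i + a); split.
- by move=> i; have [x Ax <-] := hA i; rewrite subrK.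
- by move=> i j /addIr/hinj.
- suff -> : (fun i => h i + a - a) = h by [].
  by apply/funext => i; rewrite addrK.
Qed.

Section accumulation.
Variables (R : realType) (G : zmodType) (len loss : nat -> nat).
Hypothesis loss_gt0 : forall n, (0 < loss n)%N.
Variables (p : set_system (nat * nat)) (z : nat -> bool).
Hypothesis pU : UltraFilter p.
Hypothesis pF : branch_filter len loss z `<=` p.

(** If [U] contained finitely many values, then, [g n] being injective, it would
contain boundedly many of the [g n i] at each stage, and the ultrafilter would
contain the complement. *)
Lemma limit_is_accumulation_point (F : set (G -> R)) (A : set G) (g : nat -> nat -> G) (a : G) :
  (forall n i, A (g n i)) -> (forall n, injective (g n)) ->
  (forall phi, F phi -> forall e : R, 0 < e ->
     p [set k | near_int e (phi (g k.1 k.2) - phi a)]) ->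
  accumulation_point (A : set (character_space F)) a.
Proof.
move=> gA ginj glim U [s [e [e0 sF sU]]] /finite_seqP[t tE].
pose X := [set k : nat * nat | U (g k.1 k.2)].
have pX : p X.
  have : p [set k | character_ball s e a (g k.1 k.2)].
    elim: s sF {sU} => [_|phi s IH sF].
      by apply: filterS filterT => k _ psi [].
    have ps := IH (fun psi h => sF psi (or_intror h)).
    have pphi := glim phi (sF phi (or_introl erefl)) e e0.
    apply: filterS (filterI pphi ps) => k [h1 h2] psi [<-//|]; exact: h2.
  by apply: filterS => k; exact: sU.
have pXC : p (~` X).
  apply: pF; apply: (@branch_filter_setC _ _ loss_gt0 z X (size t)) => n.
  rewrite -size_filter -(size_map (g n)); apply: uniq_leq_size.
    by rewrite map_inj_uniq ?filter_uniq ?iota_uniq//; exact: ginj.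
  move=> _ /mapP[i + ->]; rewrite mem_filter => /andP[/asboolP Xi _].
  by have : [set` t] (g n i) by rewrite -tE.
by have [k []] := filter_ex (filterI pX pXC).
Qed.

End accumulation.

Lemma ex_character_family (R : realType) (G : zmodType) :
  torsion_free G -> [set: G] #= [set: set nat] -> exists F : set (G -> R),
  [/\ forall phi, F phi -> character phi,
      forall x, x != 0 -> exists2 phi, F phi & ~ near_int (8^-1) (phi x) &
      forall f : nat -> character_space F, infinite_set (range f) ->
        exists a b, [/\ a <> b, accumulation_point (range f) a & accumulation_point (range f) b]].
Proof.
move=> tfG cardG.
have [B [kappa [kappaB kappa_fin kappa_supp kappa_basis kappa_inj]]] := ex_coordinates tfG.
have pos4 : 0 < 4^-1 :> R by rewrite invr_gt0.
have small4 : 0 < (4^-1 : R) <= 2^-1 by rewrite pos4 /=; lra.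
have [d0 d0P] := ex_concentrated small4 pos4.
have /choice[deg degP] : forall nL : nat * nat, exists d, (0 < nL.2)%N ->
    concentrated d (nL.1.+2%:R^-1 : R) (2 ^- nL.1.+2 / nL.2%:R).
  move=> [n L]; have [->|L0] := posnP L; first by exists 0%N.
  have small_n : 0 < (n.+2%:R^-1 : R) <= 2^-1.
    by rewrite invr_gt0 ltr0n /= lef_pV2 ?posrE ?ltr0n// ler_nat.
  have pos_nL : 0 < 2 ^- n.+2 / L%:R :> R.
    by rewrite divr_gt0 ?ltr0n// invr_gt0 exprn_gt0.
  by have [d dP] := ex_concentrated small_n pos_nL; exists d.
pose dg n L := deg (n, L).
have dgP n L : (0 < L)%N -> concentrated (dg n L) (n.+2%:R^-1 : R) (2 ^- n.+2 / L%:R).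
  exact: (degP (n, L)).
have lossP := loss_gt0 d0 dg.
have [p pP] := @ex_branch_ultrafilter (len d0 dg) (loss d0 dg) (fun=> erefl).
have [y y_inj] := ex_branch_index cardG.
have [xi [below [below_wf xi_inj xiB xi_below]]] :=
  ex_accumulation_index kappaB kappa_fin kappa_supp kappa_inj cardG.
have /choice[g gP] : forall c : (nat -> G) * bool, exists h : nat -> nat -> G,
    infinite_set (range c.1) -> forall n, [/\ forall i, range c.1 (h n i),
      injective (h n) & relation_free (2 * degree d0 dg n) (fun i => h n i - xi c)].
  move=> c; have [inf|fin] := pselect (infinite_set (range c.1)); last by exists (fun _ _ => 0).
  have /choice[h hP] : forall n, exists h : nat -> G, [/\ forall i, range c.1 (h i),
      injective h & relation_free (2 * degree d0 dg n) (fun i => h i - xi c)].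
    by move=> n; exact: ex_thinned_sequence.
  by exists h.
pose F := admissible p y xi g : set (G -> R).
exists F; split.
- by move=> phi [].
- move=> x x0.
  have pU z : UltraFilter (p z) by have [] := pP z.
  have pF z : branch_filter (len d0 dg) (loss d0 dg) z `<=` p z by have [] := pP z.
  apply: (@ex_admissible R G tfG B kappa kappaB kappa_fin kappa_basis kappa_inj
    d0 dg d0P dgP p pU pF y xi below y_inj below_wf xi_inj xiB xi_below g _ _ x x0).
    by move=> c n i inf; have [h _ _] := gP c inf n; exact: h.
  by move=> c n inf; have [_ _ h] := gP c inf n.
- move=> f inf; exists (xi (f, true)), (xi (f, false)); split.
  + by move=> /xi_inj[].
  + have [pU pF] := pP (y (f, true)).
    apply: (limit_is_accumulation_point lossP pU pF (g := g (f, true))).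
    * by move=> n; have [h _ _] := gP (f, true) inf n.
    * by move=> n; have [_ h _] := gP (f, true) inf n.
    * by move=> phi [_ h]; exact: h.
  + have [pU pF] := pP (y (f, false)).
    apply: (limit_is_accumulation_point lossP pU pF (g := g (f, false))).
    * by move=> n; have [h _ _] := gP (f, false) inf n.
    * by move=> n; have [_ h _] := gP (f, false) inf n.
    * by move=> phi [_ h]; exact: h.
Qed.

Theorem theorem1p1 (G : zmodType) (tfG : torsion_free G)
    (cardG : [set: G] #= [set: set nat]) :
  exists t : Topological G,
    let T := Topological.Pack t in
    [/\ group_topology t,
        hausdorff_space T,
        countably_compact [set: T] &
        forall (u : nat -> T) (l : T),
          u @ \oo --> l -> eventually_constant u].
Proof.
have [F [F_char F_sep F_acc]] := ex_character_family
  Rstruct.RbaseSymbolsImpl_R__canonical__reals_Real tfG cardG.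
exists (Topological.class (character_space F)); split.
- exact: character_topology_group.
- exact: character_topology_hausdorff.
- apply: accumulation_countably_compact => f /F_acc[a [_ [_ acca _]]].
  by exists a.
- move=> u l; apply: accumulation_eventually_constant; last exact: F_acc.
  exact: character_topology_hausdorff.
Qed.
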